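(* Let $P\subset\mathbb{R}^d$ be a set of $n$ points and let $k\in\mathbb{N}$ with $k\le n$. One iteration of the main loop of the algorithm Foresight-LS++ (that is, one execution of the steps (a)–(d) described in the context: sampling $c_{\text{new}}$, initializing the current best $C^{\min},\phi^{\min}$ by one Lloyd step, evaluating for all $k$ centers $c_{\text{old}}\in C$ the swap of $c_{\text{old}}$ for $c_{\text{new}}$ followed by one Lloyd step, and setting $C=C^{\min}$) can be implemented to run in time $\mathcal{O}(ndk)$.
   Context: Time is counted in the unit-cost real RAM model (arithmetic operations and comparisons on reals, memory accesses, and drawing a uniform sample from $[0,1]$ each cost $O(1)$). Notation. $P\subset\mathbb{R}^d$ is a set of $n$ points. A center set $C$ consists of $k$ centers in $\mathbb{R}^d$, regarded as an indexed family. Write $d(p,C)=\min_{c\in C}\|p-c\|$ and $\Phi(P,C)=d^2(P,C)=\sum_{p\in P}\min_{c\in C}\|p-c\|^2$. For an arbitrary assignment $\phi'$ of the points of $P$ to centers of $C$, $\Phi(P,C,\phi')=\sum_{p\in P}\|p-\phi'(p)\|^2$ is the cost using that assignment. Procedures. - $\mathrm{SampleCenter}(P,C)$ returns a random point of $P$, where $p\in P$ is returned with probability $d^2(p,C)/d^2(P,C)$ (if $d^2(P,C)=0$ an arbitrary point of $P$ is returned). - $\mathrm{Lloyd}(P,C,1)$ (one step of Lloyd's algorithm): assign every $p\in P$ to a closest center in $C$ (ties broken arbitrarily), giving clusters $C_1,\dots,C_k$, where $C_i$ is the set of points assigned to the $i$-th center; then replace the $i$-th center by the mean $\mu(C_i)=\frac{1}{|C_i|}\sum_{x\in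 C_i}x$ (the center is kept if $C_i=\emptyset$). It outputs the new centers together with the assignment $\phi$ computed in this step; in $\Phi(P,C',\phi')$ with $(C',\phi')$ output by this procedure, a point of the $i$-th cluster is charged its squared distance to the new $i$-th center. One iteration of the main loop of Foresight-LS++, given current centers $C$ with $k$ elements: (a) $c_{\text{new}}=\mathrm{SampleCenter}(P,C)$. (b) $(C^{\min},\phi^{\min})=\mathrm{Lloyd}(P,C,1)$. (c) For every $c_{\text{old}}\in C$: compute $(C',\phi')=\mathrm{Lloyd}(P,(C\setminus\{c_{\text{old}}\})\cup\{c_{\text{new}}\},1)$; if $\Phi(P,C',\phi')<\Phi(P,C^{\min},\phi^{\min})$, set $(C^{\min},\phi^{\min})=(C',\phi')$. (d) Set $C=C^{\min}$. *)

(* Defs.v *)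
From HB Require Import structures.
From mathcomp Require Import all_boot all_order all_algebra.
From mathcomp Require Import all_classical all_reals all_analysis.

Set Implicit Arguments.
Unset Strict Implicit.
Unset Printing Implicit Defensive.

Import Order.TTheory GRing.Theory Num.Theory.
Local Open Scope classical_set_scope.
Local Open Scope ring_scope.

(** * The unit-cost real RAM *)

(* The machine has integer registers, real registers, an integer memory and a
   real memory, both addressed indirectly through integer registers, and an
   infinite tape holding the successive uniform samples that will be drawn.
   There is no rounding, no conversion between reals and integers, and the only
   integer operations are addition and (truncated) subtraction. *)
Record state (R : realType) := State {
  ireg : nat -> nat;
  rreg : nat -> R;
  imem : nat -> nat;
  rmem : nat -> R;
  tape : nat -> R }.

Definition upd (T : Type) (f : nat -> T) (a : nat) (v : T) : nat -> T :=
  fun i => if i == a then v else f i.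

Definition set_ireg (R : realType) (s : state R) a v :=
  State (upd (ireg s) a v) (rreg s) (imem s) (rmem s) (tape s).
Definition set_rreg (R : realType) (s : state R) x v :=
  State (ireg s) (upd (rreg s) x v) (imem s) (rmem s) (tape s).
Definition set_imem (R : realType) (s : state R) a v :=
  State (ireg s) (rreg s) (upd (imem s) a v) (rmem s) (tape s).
Definition set_rmem (R : realType) (s : state R) a v :=
  State (ireg s) (rreg s) (imem s) (upd (rmem s) a v) (tape s).
Definition set_tape (R : realType) (s : state R) w :=
  State (ireg s) (rreg s) (imem s) (rmem s) w.

(* The letters a b c range over integer registers, x y z over real registers,
   m over literal constants; the destination comes first. *)
Inductive instr :=
  | IConst (a m : nat)
  | IMove (a b : nat)
  | IAdd (a b c : nat)
  | ISub (a b c : nat)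
  | ILoad (a b : nat)    (* a <- imem[b] *)
  | IStore (a b : nat)   (* imem[a] <- b *)
  | RConst (x m : nat)
  | RMove (x y : nat)
  | RAdd (x y z : nat)
  | RSub (x y z : nat)
  | RMul (x y z : nat)
  | RDiv (x y z : nat)
  | RLoad (x a : nat)    (* x <- rmem[a] *)
  | RStore (a x : nat)   (* rmem[a] <- x *)
  | RDraw (x : nat).

(* [None]: division by zero, on which the machine is stuck. *)
Definition step (R : realType) (i : instr) (s : state R) : option (state R) :=
  match i with
  | IConst a m => Some (set_ireg s a m)
  | IMove a b => Some (set_ireg s a (ireg s b))
  | IAdd a b c => Some (set_ireg s a (ireg s b + ireg s c)%N)
  | ISub a b c => Some (set_ireg s a (ireg s b - ireg s c)%N)
  | ILoad a b => Some (set_ireg s a (imem s (ireg s b)))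
  | IStore a b => Some (set_imem s (ireg s a) (ireg s b))
  | RConst x m => Some (set_rreg s x m%:R)
  | RMove x y => Some (set_rreg s x (rreg s y))
  | RAdd x y z => Some (set_rreg s x (rreg s y + rreg s z))
  | RSub x y z => Some (set_rreg s x (rreg s y - rreg s z))
  | RMul x y z => Some (set_rreg s x (rreg s y * rreg s z))
  | RDiv x y z => if rreg s z == 0 then None
                  else Some (set_rreg s x (rreg s y / rreg s z))
  | RLoad x a => Some (set_rreg s x (rmem s (ireg s a)))
  | RStore a x => Some (set_rmem s (ireg s a) (rreg s x))
  | RDraw x => Some (set_tape (set_rreg s x (tape s 0%N))
                              (fun i => tape s i.+1))
  end.

Inductive test :=
  | ILt (a b : nat)
  | IEq (a b : nat)
  | RLt (x y : nat)
  | REq (x y : nat).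

Definition holds (R : realType) (b : test) (s : state R) : bool :=
  match b with
  | ILt a b => (ireg s a < ireg s b)%N
  | IEq a b => ireg s a == ireg s b
  | RLt x y => rreg s x < rreg s y
  | REq x y => rreg s x == rreg s y
  end.

Inductive cmd :=
  | Skip
  | Instr (i : instr)
  | Seq (c1 c2 : cmd)
  | If (b : test) (c1 c2 : cmd)
  | While (b : test) (c : cmd).

(* [exec c s t s']: started in s, the program c halts in s' after exactly t
   time units; every executed instruction and every evaluated test costs 1. *)
Inductive exec (R : realType) : cmd -> state R -> nat -> state R -> Prop :=
  | ExecSkip s : exec Skip s 1 s
  | ExecInstr i s s' : step i s = Some s' -> exec (Instr i) s 1 s'
  | ExecSeq c1 c2 s s1 s2 t1 t2 :
      exec c1 s t1 s1 -> exec c2 s1 t2 s2 ->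
      exec (Seq c1 c2) s (t1 + t2)%N s2
  | ExecIf b c1 c2 s s' t :
      exec (if holds b s then c1 else c2) s t s' ->
      exec (If b c1 c2) s t.+1 s'
  | ExecWhileF b c s : ~~ holds b s -> exec (While b c) s 1 s
  | ExecWhileT b c s s1 s2 t1 t2 :
      holds b s -> exec c s t1 s1 -> exec (While b c) s1 t2 s2 ->
      exec (While b c) s (t1 + t2).+1 s2.

Lemma exec_det (R : realType) c (s : state R) t1 s1 t2 s2 :
  exec c s t1 s1 -> exec c s t2 s2 -> t1 = t2 /\ s1 = s2.
Proof.
move=> e1; elim: e1 t2 s2 => {c s t1 s1}.
- by move=> s t2 s2 e2; inversion e2.
- move=> i s s' E t2 s2 e2; inversion e2 as [|? ? ? E'| | | |]; subst.
  by move: E'; rewrite E => -[].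
- move=> c1 c2 s s1 s2 t1 t2 _ IH1 _ IH2 t' s' e2.
  inversion e2 as [| |? ? ? ? ? ? ? E1 E2| | |]; subst.
  have [-> ?] := IH1 _ _ E1; subst.
  by have [-> ->] := IH2 _ _ E2.
- move=> b c1 c2 s s' t _ IH t' s'' e2.
  inversion e2 as [| | |? ? ? ? ? ? E| |]; subst.
  by have [-> ->] := IH _ _ E.
- move=> b c s nb t' s' e2.
  inversion e2 as [| | | | |? ? ? ? ? ? ? hb]; subst => //.
  by rewrite hb in nb.
- move=> b c s s1 s2 t1 t2 hb _ IH1 _ IH2 t' s' e2.
  inversion e2 as [| | | |? ? ? nb|? ? ? ? ? ? ? ? E1 E2]; subst.
    by rewrite hb in nb.
  have [-> ?] := IH1 _ _ E1; subst.
  by have [-> ->] := IH2 _ _ E2.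
Qed.

(** * One iteration of Foresight-LS++ *)

(* The norm that MathComp-Analysis puts on 'rV[R]_d is the sup norm. *)
Definition l2norm (R : realType) (d : nat) (x : 'rV[R]_d) : R :=
  Num.sqrt (\sum_(j < d) x 0 j ^+ 2).

(* Only used for k > 0, where the infimum is a minimum: see [dist_centersP]. *)
Definition dist_centers (R : realType) (d k : nat)
    (p : 'rV[R]_d) (C : 'I_k -> 'rV[R]_d) : R :=
  inf [set l2norm (p - C i) | i in [set: 'I_k]].

Lemma dist_centersP (R : realType) (d k : nat)
    (p : 'rV[R]_d) (C : 'I_k -> 'rV[R]_d) : (0 < k)%N ->
  exists2 i, dist_centers p C = l2norm (p - C i) &
             forall j, l2norm (p - C i) <= l2norm (p - C j).
Proof.
case: k C => // k C _.
pose i := [arg min_(i < ord0) l2norm (p - C i)]%O.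
have imin j : l2norm (p - C i) <= l2norm (p - C j).
  by rewrite /i; case: arg_minP => //= i0 _; apply.
exists i => //; apply/eqP; rewrite eq_le; apply/andP; split.
  by apply: ge_inf; [exists (l2norm (p - C i)) => _ [j _ <-]|exists i].
by apply: lb_le_inf; [exists (l2norm (p - C i)), i|move=> _ [j _ <-]].
Qed.

Definition Phi (R : realType) (n d k : nat)
    (P : 'I_n -> 'rV[R]_d) (C : 'I_k -> 'rV[R]_d) : R :=
  \sum_(p < n) dist_centers (P p) C ^+ 2.

Definition Phi_assign (R : realType) (n d k : nat) (P : 'I_n -> 'rV[R]_d)
    (C : 'I_k -> 'rV[R]_d) (phi : 'I_n -> 'I_k) : R :=
  \sum_(p < n) l2norm (P p - C (phi p)) ^+ 2.

(* X is the index in P of the random point returned by SampleCenter(P, C). *)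
Definition sample_center (R : realType) (disp : measure_display)
    (Om : measurableType disp) (Pr : probability Om R) (n d k : nat)
    (P : 'I_n -> 'rV[R]_d) (C : 'I_k -> 'rV[R]_d) (X : Om -> 'I_n) : Prop :=
  forall p : 'I_n, measurable (X @^-1` [set p]) /\
    (Phi P C != 0 ->
     Pr (X @^-1` [set p]) = (dist_centers (P p) C ^+ 2 / Phi P C)%:E).

Definition closest_assignment (R : realType) (n d k : nat)
    (P : 'I_n -> 'rV[R]_d) (C : 'I_k -> 'rV[R]_d) (phi : 'I_n -> 'I_k) : Prop :=
  forall p i, l2norm (P p - C (phi p)) <= l2norm (P p - C i).

Definition cluster (n k : nat) (phi : 'I_n -> 'I_k) (i : 'I_k) : {set 'I_n} :=
  [set p | phi p == i]%SET.

Definition lloyd_centers (R : realType) (n d k : nat) (P : 'I_n -> 'rV[R]_d)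
    (C : 'I_k -> 'rV[R]_d) (phi : 'I_n -> 'I_k) : 'I_k -> 'rV[R]_d :=
  fun i => if cluster phi i == finset.set0 then C i
           else #|cluster phi i|%:R^-1 *: \sum_(p in cluster phi i) P p.

(* A relation, since ties may be broken arbitrarily. *)
Definition lloyd (R : realType) (n d k : nat) (P : 'I_n -> 'rV[R]_d)
    (C : 'I_k -> 'rV[R]_d) (out : ('I_k -> 'rV[R]_d) * ('I_n -> 'I_k)) : Prop :=
  closest_assignment P C out.2 /\ out.1 = lloyd_centers P C out.2.

(* (C \ {c_old}) U {c_new}, for the center c_old of index i. *)
Definition swap (R : realType) (d k : nat) (C : 'I_k -> 'rV[R]_d) (i : 'I_k)
    (cnew : 'rV[R]_d) : 'I_k -> 'rV[R]_d :=
  fun j => if j == i then cnew else C j.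

(* Step (c) over the indices listed in the sequence, from one value of the pair
   (C^min, phi^min) to the next. *)
Inductive swap_loop (R : realType) (n d k : nat) (P : 'I_n -> 'rV[R]_d)
    (C : 'I_k -> 'rV[R]_d) (cnew : 'rV[R]_d) :
    seq 'I_k -> ('I_k -> 'rV[R]_d) * ('I_n -> 'I_k) ->
    ('I_k -> 'rV[R]_d) * ('I_n -> 'I_k) -> Prop :=
  | SwapNil best : swap_loop P C cnew [::] best best
  | SwapCons i r best cand best' :
      lloyd P (swap C i cnew) cand ->
      swap_loop P C cnew r
        (if Phi_assign P cand.1 cand.2 < Phi_assign P best.1 best.2
         then cand else best) best' ->
      swap_loop P C cnew (i :: r) best best'.

(* C' is a possible result of steps (b)-(d), given c_new. *)
Definition foresight_iteration (R : realType) (n d k : nat)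
    (P : 'I_n -> 'rV[R]_d) (C : 'I_k -> 'rV[R]_d) (cnew : 'rV[R]_d)
    (C' : 'I_k -> 'rV[R]_d) : Prop :=
  exists init phi, lloyd P C init /\
    swap_loop P C cnew (enum 'I_k) init (C', phi).

(** * Input and output conventions, random samples *)

(* Integer registers 0, 1, 2 hold n, d, k; the real memory starts with the
   points of P, followed by the centers of C, d consecutive cells for each.
   Everything else is arbitrary. *)
Definition encodes (R : realType) (n d k : nat) (P : 'I_n -> 'rV[R]_d)
    (C : 'I_k -> 'rV[R]_d) (s : state R) : Prop :=
  [/\ ireg s 0%N = n, ireg s 1%N = d, ireg s 2%N = k,
      forall (p : 'I_n) (j : 'I_d), rmem s (p * d + j)%N = P p 0 j
    & forall (i : 'I_k) (j : 'I_d), rmem s (n * d + i * d + j)%N = C i 0 j].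

Definition iid_uniform (R : realType) (disp : measure_display)
    (Om : measurableType disp) (Pr : probability Om R)
    (U : nat -> {RV Pr >-> R}) : Prop :=
  [/\ forall i w, 0 <= U i w <= 1,
      forall (i : nat) (B : set R), measurable B ->
        distribution Pr (U i) B = uniform_prob (@ltr01 R) B
    & forall (J : seq nat) (B : nat -> set R), uniq J ->
        (forall i, measurable (B i)) ->
        Pr (\bigcap_(i in [set` J]) (U i @^-1` B i)) =
        (\prod_(i <- J) Pr (U i @^-1` B i))%E].

(* Main.v *)
Require Import Defs.
From mathcomp Require Import all_boot all_order all_algebra.
From mathcomp Require Import all_classical all_reals all_analysis.
From mathcomp Require Import zify.

(* Leaving one label out of the k+1 centers C u {c_new} gives every candidate
   of the iteration: leaving out c_old is the swap, leaving out c_new is the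
   plain Lloyd step. Once the nearest and the second nearest of these k+1
   centers are known for every point, which takes time O(ndk), the closest
   assignment of each candidate takes O(n), and its means and its cost O(nd).
   The sample is drawn by inversion: with S_p the sum of the squared distances
   of the first p points, point p is chosen when S_p < u Phi <= S_(p+1), and
   the samples u with this property form an interval of length d^2(p,C)/Phi. *)

Import Order.TTheory GRing.Theory Num.Theory.
Local Open Scope classical_set_scope.
Local Open Scope ring_scope.

Set Implicit Arguments.
Unset Strict Implicit.
Unset Printing Implicit Defensive.

(** * Timed execution of programs *)

Section Ram.
Variable R : realType.
Implicit Types (s : state R) (c : cmd).

(** A candidate also clears and rewrites the [k.+1 * d] cells of sums, counts and means. Over all
    [k.+1] candidates this adds a term of order [k * k * d], and [k <= n] is what keeps it within
    [n * d * k]. The nearest labels are computed twice: the sampling needs the distances to [C]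
    before [c_new] exists, while the candidates need [c_new] among the centers. Ties need no care,
    since [lloyd] admits every closest assignment. Randomness is kept apart from execution: for a
    fixed tape the run is deterministic and the chosen index is a plain function of the first
    sample, [pick_index]. So correctness and time are proved tape by tape, and measure theory deals
    with that function alone. *)

Definition runs c s (T : nat) (Q : state R -> Prop) : Prop :=
  exists t s', [/\ exec c s t s', (t <= T)%N & Q s'].

Lemma runs_le c s T T' Q Q' : (T <= T')%N -> (forall s', Q s' -> Q' s') ->
  runs c s T Q -> runs c s T' Q'.
Proof.
move=> TT' QQ' [t [s' [e tT q]]].
by exists t, s'; split=> //; [exact: leq_trans TT'|exact: QQ'].
Qed.

Lemma runs_time T c s T' Q : (T <= T')%N -> runs c s T Q -> runs c s T' Q.
Proof. by move=> TT'; exact: runs_le. Qed.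

Lemma runs_conseq Q c s T Q' :
  (forall s', Q s' -> Q' s') -> runs c s T Q -> runs c s T Q'.
Proof. exact: runs_le. Qed.

Lemma runs_instr i s s' Q : step i s = Some s' -> Q s' -> runs (Instr i) s 1 Q.
Proof. by move=> E q; exists 1%N, s'; split=> //; exact: ExecInstr. Qed.

Lemma runs_seq c1 c2 s T1 T2 Q :
  runs c1 s T1 (fun s' => runs c2 s' T2 Q) -> runs (Seq c1 c2) s (T1 + T2) Q.
Proof.
move=> [t1 [s1 [e1 le1 [t2 [s2 [e2 le2 q]]]]]].
by exists (t1 + t2)%N, s2; split=> //; [exact: ExecSeq e1 e2|exact: leq_add].
Qed.

(** Since [T] is only an upper bound on the time, both branches can share it. *)
Lemma runs_if b c1 c2 s T Q :
  (holds b s -> runs c1 s T Q) -> (~~ holds b s -> runs c2 s T Q) ->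
  runs (If b c1 c2) s T.+1 Q.
Proof.
move=> r1 r2; have : runs (if holds b s then c1 else c2) s T Q.
  by case: ifPn; [exact: r1|exact: r2].
by move=> [t [s' [e le q]]]; exists t.+1, s'; split=> //; exact: ExecIf.
Qed.

Fixpoint block (l : seq instr) : cmd :=
  if l is i :: l' then Seq (Instr i) (block l') else Skip.

#[global] Arguments block : simpl never.

(** A weakest precondition by computation: on a concrete list, [/=] turns it into a goal about
    explicitly updated registers and memory. *)
Fixpoint after (l : seq instr) s (Q : state R -> Prop) : Prop :=
  if l is i :: l' then if step i s is Some s' then after l' s' Q else False
  else Q s.

Lemma runs_block l s T Q :
  (size l < T)%N -> after l s Q -> runs (block l) s T Q.
Proof.
rewrite /block; elim: l s T => [|i l IH] s [|T] //= lT.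
  by move=> q; exists 1%N, s; split=> //; exact: ExecSkip.
case E: (step i s) => [s'|//] /IH-/(_ T lT) H; rewrite -add1n.
by apply: runs_seq; exact: runs_instr E H.
Qed.

Fixpoint writes (wr : instr -> seq nat) c : seq nat :=
  match c with
  | Skip => [::]
  | Instr i => wr i
  | Seq c1 c2 | If _ c1 c2 => writes wr c1 ++ writes wr c2
  | While _ c1 => writes wr c1
  end.

Definition iwr i : seq nat :=
  match i with
  | IConst a _ | IMove a _ | IAdd a _ _ | ISub a _ _ | ILoad a _ => [:: a]
  | _ => [::]
  end.

Definition rwr i : seq nat :=
  match i with
  | RConst x _ | RMove x _ | RAdd x _ _ | RSub x _ _ | RMul x _ _
  | RDiv x _ _ | RLoad x _ | RDraw x => [:: x]
  | _ => [::]
  end.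

(** Stores are indirect, so the cells they hit cannot be read off the text. For the memories and the
    tape the list is a mere flag, empty when no such instruction occurs. *)
Definition iwm i : seq nat := if i is IStore _ _ then [:: 0%N] else [::].
Definition rwm i : seq nat := if i is RStore _ _ then [:: 0%N] else [::].
Definition twr i : seq nat := if i is RDraw _ then [:: 0%N] else [::].

(* What a program cannot change, read off its text. *)
Record frame c s s' : Prop := Frame {
  fr_i : forall a, a \notin writes iwr c -> ireg s' a = ireg s a;
  fr_r : forall a, a \notin writes rwr c -> rreg s' a = rreg s a;
  fr_im : nilp (writes iwm c) -> imem s' = imem s;
  fr_rm : nilp (writes rwm c) -> rmem s' = rmem s;
  fr_t : nilp (writes twr c) -> tape s' = tape s }.

Lemma frame_refl c s : frame c s s. Proof. by []. Qed.

Lemma frame_trans c s1 s2 s3 : frame c s1 s2 -> frame c s2 s3 -> frame c s1 s3.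
Proof.
move=> [i1 r1 m1 n1 t1] [i2 r2 m2 n2 t2]; split=> [a na|a na|n|n|n].
- by rewrite i2 ?i1.
- by rewrite r2 ?r1.
- by rewrite m2 ?m1.
- by rewrite n2 ?n1.
- by rewrite t2 ?t1.
Qed.

Lemma frame_sub c c' s s' :
  (forall wr, {subset writes wr c <= writes wr c'}) ->
  frame c s s' -> frame c' s s'.
Proof.
move=> sub [i r m n t]; have nil wr : nilp (writes wr c') -> nilp (writes wr c).
  by move=> /nilP E; apply/nilP; case: (writes wr c) (sub wr) => // x l;
    rewrite E => /(_ x); rewrite inE eqxx => /(_ isT).
split=> [a na|a na|/nil|/nil|/nil] //; [apply: i|apply: r];
  by apply: contra na; exact: sub.
Qed.

Lemma exec_frame c s t s' : exec c s t s' -> frame c s s'.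
Proof.
elim=> {c s t s'} [s|i s s' H|c1 c2 s s1 s2 t1 t2 _ f1 _ f2|b c1 c2 s s' t _ f|b c s _
  |b c s s1 s2 t1 t2 _ _ f1 _ f2].
- exact: frame_refl.
- by case: i H => > /=; try case: ifP => // _; case=> <-;
    split=> //= a; rewrite inE /upd => /negPf->.
- apply: (frame_trans (frame_sub _ f1) (frame_sub _ f2)) => wr x /= xw;
    by rewrite mem_cat xw ?orbT.
- by case: holds f => f; apply: frame_sub f => wr x /= xw; rewrite mem_cat xw ?orbT.
- exact: frame_refl.
- by apply: frame_trans f2; apply: frame_sub f1 => wr x.
Qed.

Lemma runs_frame c s T Q :
  runs c s T (fun s' => frame c s s' -> Q s') -> runs c s T Q.
Proof.
by move=> [t [s' [e le q]]]; exists t, s'; split=> //; apply: q; exact: exec_frame e.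
Qed.

Definition iOne := 3%N.

Definition loop a b c : cmd :=
  Seq (Instr (IConst a 0))
      (While (ILt a b) (Seq c (Instr (IAdd a a iOne)))).

(** Per round, [T + 2] pays for the body, the increment and the test; the final [+ 2] pays for the
    initialization and the failing test. The [frame] is relative to the start of the loop, so [I]
    only has to mention what the loop changes. *)
Lemma runs_loop a b c s N T (I : nat -> state R -> Prop) :
  uniq [:: a; b; iOne] ->
  ~~ has (mem [:: a; b; iOne]) (writes iwr c) ->
  ireg s iOne = 1%N -> ireg s b = N -> I 0%N (set_ireg s a 0) ->
  (forall m s1, (m < N)%N -> ireg s1 a = m -> frame (loop a b c) s s1 ->
     I m s1 -> runs c s1 T (fun s2 => I m.+1 (set_ireg s2 a m.+1))) ->
  runs (loop a b c) s (N * (T + 2) + 2) (I N).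
Proof.
rewrite /= !inE !negb_or -andbA => /and4P[ab a1 b1 _] /hasPn wrc s1 sN I0 IS.
pose B := Seq c (Instr (IAdd a a iOne)); pose W := While (ILt a b) B.
have key m s0 : (m <= N)%N -> ireg s0 a = m -> frame (loop a b c) s s0 ->
    I m s0 -> runs W s0 ((N - m) * (T + 2) + 1) (I N).
  have nw x : x \in [:: a; b; iOne] -> x \notin writes iwr c.
    by move=> xin; apply/negP => /wrc; rewrite /= xin.
  have nwb : b \notin writes iwr (loop a b c).
    by rewrite /= inE mem_cat !inE ![b == a]eq_sym (negPf ab) /= orbF nw ?inE ?eqxx ?orbT.
  have nw1 : iOne \notin writes iwr (loop a b c).
    by rewrite /= inE mem_cat !inE ![_ == a]eq_sym (negPf a1) /= orbF nw ?inE ?eqxx ?orbT.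
  move Er: (N - m)%N => r; elim: r m Er s0 => [|r IH] m Er s0 mN sm f Im.
    have <- : m = N by lia.
    exists 1%N, s0; split=> //.
    by apply: ExecWhileF; rewrite /= sm (fr_i f) // sN; lia.
  have mltN : (m < N)%N by lia.
  have [t [s2 [e le Im1]]] := IS m s0 mltN sm f Im.
  have fc := exec_frame e.
  have eB : exec B s0 (t + 1) (set_ireg s2 a m.+1).
    apply: ExecSeq e _; apply: ExecInstr => /=; congr (Some (set_ireg _ _ _)).
    by rewrite !(fr_i fc) ?nw ?inE ?eqxx ?orbT // sm (fr_i f nw1) s1 addn1.
  have fB : frame (loop a b c) s (set_ireg s2 a m.+1).
    apply: (frame_trans f); apply: frame_sub (exec_frame eB) => wr x /= xw.
    by rewrite mem_cat xw orbT.
  have Er' : (N - m.+1)%N = r by lia.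
  have sm' : ireg (set_ireg s2 a m.+1) a = m.+1 by rewrite /= /upd eqxx.
  have [t' [s' [e' le' q]]] := IH _ Er' _ mltN sm' fB Im1.
  exists (t + 1 + t').+1, s'; split=> //; last by lia.
  by apply: ExecWhileT eB e'; rewrite /= sm (fr_i f) // sN.
have e0 : exec (Instr (IConst a 0)) s 1 (set_ireg s a 0) by exact: ExecInstr.
apply: runs_le (_ : (1 + ((N - 0) * (T + 2) + 1) <= _)%N) (fun _ h => h) _; first by lia.
apply: runs_seq; exists 1%N, (set_ireg s a 0); split=> //; apply: key => //.
  by rewrite /= /upd eqxx.
by apply: frame_sub (exec_frame e0) => wr x /= xw; rewrite mem_cat xw.
Qed.
End Ram.

(** * The program *)

(* With nd = n * d, kd = k * d and kd1 = kd + d, the real memory consists of the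
   points (nd cells), the centers (kd), c_new (d), the cluster sums, the cluster
   counts, the best centers so far (kd1 each, from [iWb], [iCb], [iBb]) and the
   squared distances to the nearest centers (n, from [iDb]). Label k is c_new,
   so that the centers of all k+1 labels are contiguous; until c_new is drawn,
   its slot holds a copy of the first center.
   As there is no integer product, labels are kept per coordinate: the cell
   x = p * d + j of a point is mapped to the cell l * d + j of its center. The
   integer memory consists of four blocks of nd cells, holding at x the cell of
   the nearest label, that label, the cell of the second nearest label, and the
   cell assigned by the current candidate. *)
Definition iN := 0%N.     Definition iD := 1%N.     Definition iK := 2%N.
Definition iZero := 4%N.  Definition iK1 := 5%N.    Definition iND := 6%N.
Definition iKD := 7%N.    Definition iKD1 := 8%N.   Definition iWb := 9%N.
Definition iCb := 10%N.   Definition iBb := 11%N.   Definition iDb := 12%N.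
Definition iND2 := 13%N.  Definition iND3 := 14%N.
Definition iX := 15%N.    Definition iT := 16%N.    Definition iSrc := 17%N.
Definition iDst := 18%N.  Definition iLen := 19%N.  Definition iP := 20%N.
Definition iPP := 21%N.   Definition iL := 22%N.    Definition iO := 23%N.
Definition iEP := 24%N.   Definition iJ := 25%N.    Definition iL1 := 26%N.
Definition iO1 := 27%N.   Definition iO2 := 28%N.   Definition iU := 29%N.
Definition iI := 30%N.    Definition iIO := 31%N.

Definition x0 := 0%N.     Definition x1 := 1%N.     Definition xD := 2%N.
Definition xD1 := 3%N.    Definition xD2 := 4%N.    Definition xS := 5%N.
Definition xR := 6%N.     Definition xC := 7%N.     Definition xBest := 8%N.
Definition xOne := 9%N.   Definition xZero := 10%N.

Definition copy := loop iX iLen (block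
 [:: IAdd iT iSrc iX; RLoad x0 iT; IAdd iT iDst iX; RStore iT x0]).

Definition sqdist_prog := Seq (Instr (RConst xD 0)) (loop iJ iD (block
  [:: IAdd iT iPP iJ; RLoad x0 iT; IAdd iT iEP iJ; RLoad x1 iT;
      RSub x0 x0 x1; RMul x0 x0 x0; RAdd xD xD x0])).

Definition insert_first := block
  [:: RMove xD2 xD1; IMove iO2 iO1; RMove xD1 xD; IMove iL1 iL; IMove iO1 iO].
Definition insert_second := block [:: RMove xD2 xD; IMove iO2 iO].

(** [xD1] and [xD2] start with arbitrary contents and no number can serve as infinity, so tests on
    the label decide the first two insertions. *)
Definition insert_prog :=
  If (IEq iL iZero) insert_first
 (If (RLt xD xD1) insert_first
 (If (IEq iL iOne) insert_second
 (If (RLt xD xD2) insert_second Skip))).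

Definition scan_centers :=
  Seq (block [:: IConst iL1 0; IConst iO1 0; IConst iO2 0; IConst iO 0])
      (loop iL iK1 (Seq (Instr (IAdd iEP iND iO)) (Seq sqdist_prog
        (Seq insert_prog (Instr (IAdd iO iO iD)))))).

Definition write_labels := loop iJ iD (block
  [:: IAdd iT iPP iJ; IAdd iU iO1 iJ; IStore iT iU;
      IAdd iT iT iND; IStore iT iL1;
      IAdd iT iT iND; IAdd iU iO2 iJ; IStore iT iU]).

Definition nearest_two :=
  Seq (Instr (IConst iPP 0)) (loop iP iN (Seq scan_centers (Seq write_labels
    (block [:: IAdd iT iDb iP; RStore iT xD1; IAdd iPP iPP iD])))).

(* The first component is junk for m = 0, and the second for m < 2. *)
Fixpoint top2 (R : realType) (D : nat -> R) (m : nat) : nat * nat :=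
  if m is m'.+1 then
    let: (a, b) := top2 D m' in
    if (m' == 0%N) || (D m' < D a) then (m', a)
    else if (m' == 1%N) || (D m' < D b) then (a, m') else (a, b)
  else (0%N, 0%N).

#[global] Arguments top2 : simpl never.

Lemma top2S (R : realType) (D : nat -> R) m : top2 D m.+1 =
  let: (a, b) := top2 D m in
  if (m == 0%N) || (D m < D a) then (m, a)
  else if (m == 1%N) || (D m < D b) then (a, m) else (a, b).
Proof. by []. Qed.

(** A new minimum demotes the old one, which is then the best of the rest; any other value can
    displace only the second. *)
Lemma top2P (R : realType) (D : nat -> R) m a b : top2 D m = (a, b) ->
  ((0 < m)%N -> (a < m)%N /\ forall l, (l < m)%N -> D a <= D l) /\
  ((1 < m)%N -> [/\ (b < m)%N, b != a &
                 forall l, (l < m)%N -> l != a -> D b <= D l]).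
Proof.
elim: m a b => [//|m IH] a b; rewrite top2S.
case E: (top2 D m) => [a' b']; have {IH} [IH1 IH2] := IH _ _ E.
case: ifPn => [h [<- <-]|].
  split=> [_|m_gt0].
    split=> // l; rewrite ltnS leq_eqVlt => /predU1P[->//|lm].
    case/orP: h => [/eqP h|/ltW h]; first by lia.
    by have [_ /(_ l lm)] := IH1 (leq_ltn_trans (leq0n l) lm); exact: le_trans.
  have [am le_a] := IH1 m_gt0; split; [by lia|by lia|move=> l].
  by rewrite ltnS leq_eqVlt => /predU1P[->|lm _]; [rewrite eqxx|exact: le_a].
rewrite negb_or -leNgt -lt0n => /andP[m_gt0 le_am].
have [am le_a] := IH1 m_gt0.
have le_a' l : (l < m.+1)%N -> D a' <= D l.
  by rewrite ltnS leq_eqVlt => /predU1P[->|]; [|exact: le_a].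
case: ifPn => [h [<- <-]|]; last rewrite negb_or -leNgt => /andP[m1 le_bm] [<- <-].
  split=> _; first by split=> //; lia.
  split=> // [|l]; first by lia.
  rewrite ltnS leq_eqVlt => /predU1P[->//|lm] la.
  case/orP: h => [/eqP h|/ltW h]; first by lia.
  have m_gt1 : (1 < m)%N by lia.
  by have [_ _ /(_ l lm la)] := IH2 m_gt1; exact: le_trans.
have m_gt1 : (1 < m)%N by lia.
have [bm ba le_b] := IH2 m_gt1.
split=> _; first by split=> //; lia.
split=> // [|l]; first by lia.
by rewrite ltnS leq_eqVlt => /predU1P[->//|lm la]; exact: le_b.
Qed.

(** Junk components are never compared: the tests on [m] short-circuit, and after them [top2P]
    bounds both labels by [m]. *)
Lemma eq_top2 (R : realType) (D D' : nat -> R) m :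
  (forall l, (l < m)%N -> D l = D' l) -> top2 D m = top2 D' m.
Proof.
elim: m => [//|m IH] H; rewrite !top2S -IH; last by move=> l lm; apply: H; lia.
case E: (top2 D m) => [a b]; have [h1 h2] := top2P E.
rewrite H //; case: eqP => //= m0;
have m_gt0 : (0 < m)%N by lia.
have [am _] := h1 m_gt0.
rewrite (H a); last by lia.
case: ifP => // _; case: eqP => //= m1.
have m_gt1 : (1 < m)%N by lia.
have [bm _ _] := h2 m_gt1.
by rewrite (H b) //; lia.
Qed.

(** * Correctness and time of the search for the two nearest centers *)

Section NearestTwo.
Variable R : realType.
Implicit Types s : state R.

Record env (n d k nd kd : nat) s : Prop := Env {
  e_n : ireg s iN = n; e_d : ireg s iD = d; e_k : ireg s iK = k;
  e_one : ireg s iOne = 1%N; e_zero : ireg s iZero = 0%N;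
  e_k1 : ireg s iK1 = k.+1; e_nd : ireg s iND = nd; e_kd : ireg s iKD = kd;
  e_kd1 : ireg s iKD1 = (kd + d)%N;
  e_wb : ireg s iWb = (nd + (kd + d))%N;
  e_cb : ireg s iCb = (nd + (kd + d) + (kd + d))%N;
  e_bb : ireg s iBb = (nd + (kd + d) + (kd + d) + (kd + d))%N;
  e_db : ireg s iDb = (nd + (kd + d) + (kd + d) + (kd + d) + (kd + d))%N;
  e_nd2 : ireg s iND2 = (nd + nd)%N; e_nd3 : ireg s iND3 = (nd + nd + nd)%N }.

(** Registers below 15 are reserved for sizes and base addresses. After [setup] no routine writes to
    them, which the last hypothesis checks by computation. *)
Lemma env_frame n d k nd kd c s s' :
  frame c s s' -> env n d k nd kd s -> all (leq 15) (writes iwr c) ->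
  env n d k nd kd s'.
Proof.
move=> f e /allP w; have H a : (a < 15)%N -> ireg s' a = ireg s a.
  by move=> a15; apply: (fr_i f); apply/negP => /w; rewrite leqNgt a15.
by case: e => *; split; rewrite H.
Qed.

(** Cells are copied in ascending order, so an overlap is harmless when [dst <= src]: a cell is
    overwritten only after it has been read. The case [dst = src] does occur, in [candidate]. *)
Lemma copyP s (src dst N : nat) :
  ireg s iOne = 1%N -> ireg s iSrc = src -> ireg s iDst = dst ->
  ireg s iLen = N -> (dst <= src)%N || (src + N <= dst)%N ->
  runs copy s (7 * N + 2) (fun s' => forall y, rmem s' y =
    if (dst <= y < dst + N)%N then rmem s (src + (y - dst))%N else rmem s y).
Proof.
move=> s1 sS sD sN ov.
apply: runs_le (runs_loop (I := fun m s' => forall y, rmem s' y =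
    if (dst <= y < dst + m)%N then rmem s (src + (y - dst))%N else rmem s y)
    (T := 5) _ _ s1 sN _ _) => //; first by lia.
  by move=> y /=; case: ifP => //; lia.
move=> m s0 mN sm f H; apply: runs_block => //=; rewrite /upd /=.
have -> : ireg s0 iSrc = src by rewrite (fr_i f).
have -> : ireg s0 iDst = dst by rewrite (fr_i f).
rewrite sm => y; rewrite !H; case: eqP => [->|ny].
  by rewrite ifF ?ifT ?addKn //; lia.
by do 2! case: ifP => //; lia.
Qed.

Definition sqdist (M : nat -> R) (d pp ep : nat) : R :=
  \sum_(0 <= j < d) (M (pp + j)%N - M (ep + j)%N) ^+ 2.

Lemma sqdistP n d k nd kd s pp ep :
  env n d k nd kd s -> ireg s iPP = pp -> ireg s iEP = ep ->
  runs sqdist_prog s (10 * d + 3)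
    (fun s' => rreg s' xD = sqdist (rmem s) d pp ep).
Proof.
move=> e sP sE; apply: (@runs_time _ (1 + (d * (8 + 2) + 2))); first by lia.
apply: runs_seq; apply: runs_instr => //=.
apply: (runs_loop (I := fun m s' => rreg s' xD = sqdist (rmem s) m pp ep)) => //=.
- exact: e_one e.
- exact: e_d e.
- by rewrite /sqdist big_nil.
move=> m s0 mN sm f H; apply: runs_block => //=; rewrite /upd /=.
have -> : ireg s0 iPP = pp by rewrite (fr_i f).
have -> : ireg s0 iEP = ep by rewrite (fr_i f).
by rewrite sm H (fr_rm f) //= /sqdist big_nat_recr //= expr2.
Qed.

(** Labels and offsets agree with [top2] even where it is junk, because the registers start at 0
    like [top2 D 0]; distances are asserted only once they are genuine. *)
Lemma insertP s D m a b d :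
  ireg s iOne = 1%N -> ireg s iZero = 0%N ->
  ireg s iL = m -> ireg s iO = (m * d)%N -> rreg s xD = D m ->
  top2 D m = (a, b) ->
  ireg s iL1 = a -> ireg s iO1 = (a * d)%N -> ireg s iO2 = (b * d)%N ->
  ((0 < m)%N -> rreg s xD1 = D a) -> ((1 < m)%N -> rreg s xD2 = D b) ->
  runs insert_prog s 10 (fun s' => let: (a, b) := top2 D m.+1 in
    [/\ ireg s' iL1 = a, ireg s' iO1 = (a * d)%N, ireg s' iO2 = (b * d)%N,
        rreg s' xD1 = D a & (0 < m)%N -> rreg s' xD2 = D b]).
Proof.
move=> s1 s0 sL sO sD E sL1 sO1 sO2 sD1 sD2; rewrite top2S E.
have first_case : runs insert_first s 6 (fun s' =>
    [/\ ireg s' iL1 = m, ireg s' iO1 = (m * d)%N, ireg s' iO2 = (a * d)%N,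
        rreg s' xD1 = D m & (0 < m)%N -> rreg s' xD2 = D a]).
  by apply: runs_block => //=; rewrite /upd /= sO1 sD sL sO; split.
have second_case : (0 < m)%N -> runs insert_second s 3 (fun s' =>
    [/\ ireg s' iL1 = a, ireg s' iO1 = (a * d)%N, ireg s' iO2 = (m * d)%N,
        rreg s' xD1 = D a & (0 < m)%N -> rreg s' xD2 = D m]).
  by move=> m0; apply: runs_block => //=; rewrite /upd /= sO sD sO1 sL1 sD1.
apply: runs_if; rewrite /= sL s0 => m0.
  by rewrite m0; apply: runs_time first_case.
have m_gt0 : (0 < m)%N by rewrite lt0n.
rewrite (negPf m0) /=; apply: runs_if; rewrite /= sD sD1 // => Dma.
  by rewrite Dma; apply: runs_time first_case.
rewrite (negPf Dma); apply: runs_if; rewrite /= sL s1 => m1.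
  by rewrite m1; apply: runs_time (second_case m_gt0).
have m_gt1 : (1 < m)%N by rewrite ltn_neqAle eq_sym m1.
rewrite (negPf m1) /=; apply: runs_if; rewrite /= sD sD2 // => Dmb.
  by rewrite Dmb; apply: runs_time (second_case m_gt0).
rewrite (negPf Dmb); exists 1%N, s; split=> //; first exact: ExecSkip.
by rewrite sD1 // sD2.
Qed.

Lemma scan_centersP n d k nd kd s pp :
  env n d k nd kd s -> ireg s iPP = pp ->
  runs scan_centers s (k.+1 * (10 * d + 17) + 7) (fun s' =>
    let D l := sqdist (rmem s) d pp (nd + l * d) in
    let: (a, b) := top2 D k.+1 in
    [/\ ireg s' iL1 = a, ireg s' iO1 = (a * d)%N, ireg s' iO2 = (b * d)%N &
        rreg s' xD1 = D a]).
Proof.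
move=> e sP; apply: (@runs_time _ (5 + (k.+1 * (10 * d + 15 + 2) + 2))); first by lia.
apply: runs_seq; apply: runs_block => //=.
set D := fun l => sqdist (rmem s) d pp (nd + l * d).
set si := set_ireg _ _ _.
apply: runs_conseq (runs_loop (N := k.+1) (I := fun m s' =>
  let: (a, b) := top2 D m in
  [/\ [/\ ireg s' iL1 = a, ireg s' iO1 = (a * d)%N, ireg s' iO2 = (b * d)%N &
    ireg s' iO = (m * d)%N], (0 < m)%N -> rreg s' xD1 = D a &
    (1 < m)%N -> rreg s' xD2 = D b]) _ _ _ _ _ _) => //.
- by move=> s' /=; case: (top2 _ _) => a b [[]] ? ? ? ? /(_ isT).
- exact: e_one e.
- exact: e_k1 e.
move=> m s0 mN sm f; case Et: (top2 D m) => [a b] H.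
have {}e : env n d k nd kd s0.
  apply: (env_frame f) => //.
  by case: e => *; split.
have sP0 : ireg s0 iPP = pp by rewrite (fr_i f).
apply: (@runs_time _ (1 + ((10 * d + 3) + (10 + 1)))); first by lia.
case: H => -[H1 H2 H3 H4] H5 H6.
apply: runs_seq; apply: runs_instr => //=; set s2 := set_ireg _ _ _.
have e2 : env n d k nd kd s2 by case: (e) => *; split.
apply: runs_seq; apply: runs_frame.
apply: runs_conseq (sqdistP (pp := pp) (ep := (nd + m * d)%N) e2 _ _) => //; last first.
  by rewrite /s2 /= /upd /= H4 (e_nd e).
move=> s3 E3 f3; apply: runs_seq.
have [b1 b2] : rreg s3 xD1 = rreg s0 xD1 /\ rreg s3 xD2 = rreg s0 xD2.
  by split; rewrite (fr_r f3).
have DE l : sqdist (rmem s2) d pp (nd + l * d) = D l by rewrite /s2 /= (fr_rm f).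
apply: runs_frame.
apply: runs_conseq (insertP (D := D) (m := m) (d := d) _ _ _ _ _ Et _ _ _ _ _);
  rewrite ?b1 ?b2 ?E3 ?DE ?(fr_i f3) // ?(e_one e2) ?(e_zero e2) //.
move=> s4; case: (top2 D m.+1) => a' b' [? ? ? ? ?] f4; apply: runs_instr => //=.
have sO4 : ireg s4 iO = (m * d)%N by rewrite (fr_i f4) // (fr_i f3).
have sD4 : ireg s4 iD = d by rewrite (fr_i f4) // (fr_i f3) // (e_d e2).
by rewrite /upd /= sO4 sD4 mulSn addnC.
Qed.

Definition labels_at (M : nat -> nat) (nd x l1 o1 o2 j : nat) : Prop :=
  [/\ M (x + j)%N = (o1 + j)%N, M (nd + (x + j))%N = l1 &
      M (nd + nd + (x + j))%N = (o2 + j)%N].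

(** The bound [pp + d <= nd] keeps the three stores of a round in separate blocks. The second clause
    preserves the labels of the points already treated, as the loop over the points requires. *)
Lemma write_labelsP n d k nd kd s pp l1 o1 o2 :
  env n d k nd kd s -> ireg s iPP = pp -> (pp + d <= nd)%N ->
  ireg s iL1 = l1 -> ireg s iO1 = o1 -> ireg s iO2 = o2 ->
  runs write_labels s (11 * d + 2) (fun s' =>
    (forall j, (j < d)%N -> labels_at (imem s') nd pp l1 o1 o2 j) /\
    (forall x j, (j < d)%N -> (x + d <= pp)%N -> forall l1 o1 o2,
       labels_at (imem s) nd x l1 o1 o2 j -> labels_at (imem s') nd x l1 o1 o2 j)).
Proof.
move=> e sP le sL1 sO1 sO2.
apply: (@runs_time _ (d * (9 + 2) + 2)); first by lia.
apply: (runs_loop (I := fun m s' =>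
    (forall j, (j < m)%N -> labels_at (imem s') nd pp l1 o1 o2 j) /\
    (forall x j, (j < d)%N -> (x + d <= pp)%N -> forall l1 o1 o2,
       labels_at (imem s) nd x l1 o1 o2 j -> labels_at (imem s') nd x l1 o1 o2 j))) => //.
- exact: e_one e.
- exact: e_d e.
move=> m s0 mN sm f [H1 H2]; apply: runs_block => //=; rewrite /upd /=.
have -> : ireg s0 iPP = pp by rewrite (fr_i f).
have -> : ireg s0 iL1 = l1 by rewrite (fr_i f).
have -> : ireg s0 iO1 = o1 by rewrite (fr_i f).
have -> : ireg s0 iO2 = o2 by rewrite (fr_i f).
have -> : ireg s0 iND = nd by rewrite (fr_i f) // (e_nd e).
rewrite sm; split=> [j jm|x j jd xpp a b c].
  have [->|/eqP jnm] := eqVneq j m.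
    by split; do ?[rewrite ifF; last by lia]; rewrite ?ifT //; lia.
  have [|h1 h2 h3] := H1 j; first by lia.
  by split; do ?[rewrite ifF; last by lia].
move=> /(H2 _ _ jd xpp) [h1 h2 h3].
by split; do ?[rewrite ifF; last by lia].
Qed.

Lemma eq_sqdist (M M' : nat -> R) d pp ep :
  (forall j, (j < d)%N -> M (pp + j)%N = M' (pp + j)%N) ->
  (forall j, (j < d)%N -> M (ep + j)%N = M' (ep + j)%N) ->
  sqdist M d pp ep = sqdist M' d pp ep.
Proof.
by move=> H1 H2; apply: eq_big_nat => j /andP[_ jd]; rewrite H1 ?H2.
Qed.

Lemma nearest_twoP n d k s :
  let nd := (n * d)%N in let kd := (k * d)%N in
  let db := (nd + (kd + d) + (kd + d) + (kd + d) + (kd + d))%N in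
  env n d k nd kd s ->
  runs nearest_two s (n * (k.+1 * (10 * d + 17) + 11 * d + 15) + 3) (fun s' =>
    (forall p, (p < n)%N ->
      let D l := sqdist (rmem s) d (p * d) (nd + l * d) in
      let: (a, b) := top2 D k.+1 in
      rmem s' (db + p)%N = D a /\
      forall j, (j < d)%N -> labels_at (imem s') nd (p * d) a (a * d) (b * d) j)
    /\ forall y, (y < db)%N -> rmem s' y = rmem s y).
Proof.
move=> nd kd db e.
pose D p l := sqdist (rmem s) d (p * d) (nd + l * d).
apply: (@runs_time _ (1 + (n * (k.+1 * (10 * d + 17) + 7 + (11 * d + 2 + 4) + 2) + 2)));
  first by lia.
apply: runs_seq; apply: runs_instr => //=.
set si := set_ireg _ _ _.
have ei : env n d k nd kd si by case: (e) => *; split.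
apply: runs_conseq (runs_loop (N := n) (I := fun m s' =>
  [/\ ireg s' iPP = (m * d)%N,
    forall p, (p < m)%N -> let: (a, b) := top2 (D p) k.+1 in
      rmem s' (db + p)%N = D p a /\
      forall j, (j < d)%N -> labels_at (imem s') nd (p * d) a (a * d) (b * d) j
    & forall y, (y < db)%N -> rmem s' y = rmem s y]) _ _ _ _ _ _) => //.
- by move=> s' [].
- exact: e_one e.
- exact: e_n e.
move=> m s0 mn sm f [H1 H2 H3].
have e0 : env n d k nd kd s0 by exact: (env_frame f ei).
have mnd : (m * d + d <= nd)%N by rewrite addnC -mulSn leq_mul2r mn orbT.
apply: runs_seq; apply: runs_frame.
apply: runs_conseq (scan_centersP e0 H1) => s1 /=.
(* The distances depend only on cells below [db], where the loop has not written. *)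
have DE l : (l < k.+1)%N -> sqdist (rmem s0) d (m * d) (nd + l * d) = D m l.
  move=> lk; have lkd : (l * d + d <= kd + d)%N.
    by rewrite leq_add2r leq_mul2r -ltnS lk orbT.
  by apply: eq_sqdist => j jd; apply: H3; rewrite /db; lia.
rewrite (eq_top2 DE); case E: (top2 (D m) k.+1) => [a b] [L1 O1 O2 D1] f1.
have [am _] := (top2P E).1 isT.
rewrite DE // in D1.
have P1 : ireg s1 iPP = (m * d)%N by rewrite (fr_i f1).
have e1 : env n d k nd kd s1 by exact: (env_frame f1 e0).
apply: runs_seq; apply: runs_frame.
apply: runs_conseq (write_labelsP e1 P1 mnd L1 O1 O2) => s2 [W1 W2] f2.
have e2 : env n d k nd kd s2 by exact: (env_frame f2 e1).
have rm2 : rmem s2 = rmem s0 by rewrite (fr_rm f2) // (fr_rm f1).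
have D2 : rreg s2 xD1 = D m a by rewrite (fr_r f2).
have P2 : ireg s2 iPP = (m * d)%N by rewrite (fr_i f2).
have m2 : ireg s2 iP = m by rewrite (fr_i f2) // (fr_i f1).
apply: runs_block => //=; rewrite /upd /= (e_d e2) (e_db e2) D2 P2 m2 rm2.
split=> [|p|y yb]; first by rewrite mulSn addnC.
  rewrite ltnS leq_eqVlt => /predU1P[->|pm].
    by rewrite E eqxx.
  have := H2 p pm; case: (top2 (D p) k.+1) => a' b' [r l]; split.
    by rewrite ifF // /db; lia.
  move=> j jd; apply: W2 => //; last by rewrite (fr_im f1) //; exact: l.
  by rewrite addnC -mulSn leq_mul2r pm orbT.
by rewrite ifF ?H3 // /db; lia.
Qed.

End NearestTwo.

(** * Programs for the memory layout, the sampling and one candidate *)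

Definition setup := Seq (block [:: IConst iOne 1; IConst iZero 0;
    IAdd iK1 iK iOne; IConst iND 0; IConst iKD 0])
  (Seq (loop iX iN (Instr (IAdd iND iND iD)))
  (Seq (loop iX iK (Instr (IAdd iKD iKD iD)))
  (block [:: IAdd iKD1 iKD iD; IAdd iWb iND iKD1; IAdd iCb iWb iKD1;
    IAdd iBb iCb iKD1; IAdd iDb iBb iKD1; IAdd iND2 iND iND;
    IAdd iND3 iND2 iND]))).

Definition total_dist := Seq (Instr (RConst xS 0)) (loop iX iN
  (block [:: IAdd iT iDb iX; RLoad x0 iT; RAdd xS xS x0])).

(** There is no early exit: the partial sums of squared distances never decrease, so the point
    wanted is the last one whose preceding sum is below [xR], and each success overwrites the
    previous one. *)
Definition pick_point := loop iX iN
  (Seq (If (RLt xS xR) (Instr (IMove iSrc iPP)) Skip)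
  (block [:: IAdd iT iDb iX; RLoad x0 iT; RAdd xS xS x0; IAdd iPP iPP iD])).

(** The sample is multiplied by the total instead of dividing the distances by it, so a zero total
    neither blocks the machine nor needs a special case: point 0 is chosen. *)
Definition sample := Seq total_dist
  (Seq (block [:: RDraw x0; RMul xR x0 xS; RConst xS 0; IConst iSrc 0;
                  IConst iPP 0])
  (Seq pick_point
  (Seq (block [:: IAdd iDst iND iKD; IMove iLen iD]) copy))).

Definition zero_sums := Seq (block [:: IAdd iLen iKD1 iKD1; RConst xZero 0])
  (loop iX iLen (block [:: IAdd iT iWb iX; RStore iT xZero])).

(** Cluster sizes are counted in reals, since an integer count could not be converted for the
    division. There is one count per coordinate, because a label is available as the offset of a
    cell. *)
Definition add_sums := Seq (Instr (RConst xOne 1)) (loop iX iND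
  (Seq (block [:: IAdd iT iND iX; ILoad iU iT])
  (Seq (If (IEq iU iI) (block [:: IAdd iT iT iND; ILoad iU iT])
           (Instr (ILoad iU iX)))
  (block [:: IAdd iT iND3 iX; IStore iT iU; IAdd iT iWb iU; RLoad x0 iT;
    RLoad x1 iX; RAdd x0 x0 x1; RStore iT x0; IAdd iT iCb iU; RLoad x0 iT;
    RAdd x0 x0 xOne; RStore iT x0])))).

(** A zero count means an empty cluster: the old center is reloaded, which also avoids the division
    on which the machine would be stuck. *)
Definition divide_sums := loop iX iKD1
  (Seq (block [:: IAdd iT iCb iX; RLoad x1 iT; IAdd iU iWb iX])
  (Seq (If (REq x1 xZero) (block [:: IAdd iT iND iX; RLoad x0 iT])
           (block [:: RLoad x0 iU; RDiv x0 x0 x1]))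
  (Instr (RStore iU x0)))).

Definition cost_prog := Seq (Instr (RConst xC 0)) (loop iX iND
  (block [:: IAdd iT iND3 iX; ILoad iU iT; IAdd iT iWb iU; RLoad x0 iT;
    RLoad x1 iX; RSub x1 x1 x0; RMul x1 x1 x1; RAdd xC xC x1])).

(** The final copy moves the mean of label [k] to the position of the left-out label, so the first
    [kd] cells list the result in the order of the swapped family. It comes after the cost, which is
    still computed with all [k.+1] labels. For the plain Lloyd step it copies a block onto
    itself. *)
Definition candidate := Seq zero_sums (Seq add_sums (Seq divide_sums
  (Seq cost_prog
  (Seq (block [:: IAdd iSrc iWb iKD; IAdd iDst iWb iIO; IMove iLen iD])
       copy)))).

(** The generalized inverse of the partial sums: the largest index below [m] whose partial sum is
    below [r]. The default 0 decides the case [r = 0], that is, a zero sample or a zero total. *)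
Fixpoint pick_index (R : realType) (D : nat -> R) (r : R) (m : nat) : nat :=
  if m is m'.+1 then
    if \sum_(0 <= q < m') D q < r then m' else pick_index D r m'
  else 0%N.

(** * Correctness and time of the memory layout and of the sampling *)

Section SetupAndSampling.
Variable R : realType.
Implicit Types s : state R.

(** Integers cannot be multiplied, so [n * d] and [k * d] arise from [n] and [k] repeated
    additions. *)
Lemma setupP n d k s :
  ireg s iN = n -> ireg s iD = d -> ireg s iK = k ->
  runs setup s (3 * n + 3 * k + 18) (env n d k (n * d) (k * d)).
Proof.
move=> sN sD sK.
apply: (@runs_time _ (6 + ((n * (1 + 2) + 2) + ((k * (1 + 2) + 2) + 8)))); first by lia.
apply: runs_seq; apply: runs_block => //=; rewrite /upd /=; set s0 := set_ireg _ _ _.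
apply: runs_seq; apply: runs_frame.
apply: runs_conseq (runs_loop (N := n)
    (I := fun m s' => ireg s' iND = (m * d)%N) _ _ _ _ _ _) => //=; last first.
  move=> m s1 mn sm f E; apply: runs_instr => //=; rewrite /upd /= E (fr_i f) //= /upd /= sD.
  by rewrite mulSn addnC.
move=> s1 E1 f1; apply: runs_seq; apply: runs_frame.
apply: runs_conseq (runs_loop (N := k)
    (I := fun m s' => ireg s' iKD = (m * d)%N) _ _ _ _ _ _) => //=;
  rewrite /upd /= ?(fr_i f1) //; last first.
  move=> m s2 mn sm f E; apply: runs_instr => //=; rewrite /upd /= E.
  rewrite !(fr_i f) // (fr_i f1) //= /upd /= sD.
  by rewrite mulSn addnC.
move=> s2 E2 f2; apply: runs_block => //=; rewrite /upd /=.
have E21 a : a \notin [:: iND; iKD; iX] -> ireg s2 a = ireg s0 a.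
  rewrite !inE !negb_or => /and3P[/negPf h1 /negPf h2 /negPf h3].
  by rewrite (fr_i f2) ?(fr_i f1) //= !inE ?h1 ?h2 ?h3.
have E3 : ireg s2 iND = (n * d)%N by rewrite (fr_i f2).
by split; rewrite //= /upd /= ?E3 ?E2 ?E21 //= /upd /= ?sK ?sN ?sD ?addn1 // !addnA.
Qed.

Lemma total_distP n d k nd kd s :
  let db := (nd + (kd + d) + (kd + d) + (kd + d) + (kd + d))%N in
  env n d k nd kd s ->
  runs total_dist s (6 * n + 3) (fun s' =>
    rreg s' xS = \sum_(0 <= p < n) rmem s (db + p)%N).
Proof.
move=> db e; apply: (@runs_time _ (1 + (n * (4 + 2) + 2))); first by lia.
apply: runs_seq; apply: runs_instr => //=.
apply: (runs_loop (I := fun m s' =>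
  rreg s' xS = \sum_(0 <= p < m) rmem s (db + p)%N)) => //=.
- exact: e_one e.
- exact: e_n e.
- by rewrite big_nil.
move=> m s0 mN sm f H; apply: runs_block => //=; rewrite /upd /=.
by rewrite sm H (fr_rm f) //= (fr_i f) // (e_db e) big_nat_recr.
Qed.

Lemma pick_pointP n d k nd kd s r :
  let db := (nd + (kd + d) + (kd + d) + (kd + d) + (kd + d))%N in
  let D p := rmem s (db + p)%N in
  env n d k nd kd s -> rreg s xR = r -> rreg s xS = 0 ->
  ireg s iSrc = 0%N -> ireg s iPP = 0%N ->
  runs pick_point s (9 * n + 2) (fun s' => ireg s' iSrc = (pick_index D r n * d)%N).
Proof.
move=> db D e sR sS s1 s2; apply: (@runs_time _ (n * (2 + 5 + 2) + 2)); first by lia.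
apply: runs_conseq (runs_loop (N := n) (I := fun m s' =>
  [/\ rreg s' xS = \sum_(0 <= p < m) D p, ireg s' iPP = (m * d)%N &
      ireg s' iSrc = (pick_index D r m * d)%N]) _ _ _ _ _ _) => //=.
- by move=> s' [].
- exact: e_one e.
- exact: e_n e.
- by rewrite big_nil.
move=> m s0 mN sm f [H1 H2 H3]; apply: runs_seq; apply: runs_frame.
apply: (@runs_conseq _ (fun s' => ireg s' iSrc = (pick_index D r m.+1 * d)%N)) => [s3 E f3|].
  apply: runs_block => //=; rewrite /upd /= big_nat_recr //= (fr_r f3) // H1.
  have -> : ireg s3 iDb = db by rewrite (fr_i f3) // (fr_i f) // (e_db e).
  have -> : ireg s3 iX = m by rewrite (fr_i f3).
  have -> : ireg s3 iPP = (m * d)%N by rewrite (fr_i f3).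
  have -> : ireg s3 iD = d by rewrite (fr_i f3) // (fr_i f) // (e_d e).
  by rewrite (fr_rm f3) // (fr_rm f) // mulSnr.
have rE : rreg s0 xR = r by rewrite (fr_r f).
apply: runs_if; rewrite /= H1 rE => h.
  by apply: runs_instr => //=; rewrite /upd /= h H2.
by exists 1%N, s0; split=> //; [exact: ExecSkip|rewrite (negPf h)].
Qed.

Lemma pick_index_lt (D : nat -> R) r m : (0 < m)%N -> (pick_index D r m < m)%N.
Proof.
elim: m => // m IH _ /=; case: ifP => // _.
by case: m IH => //= m IH; rewrite ltnW // ltnS; exact: IH.
Qed.

Lemma sampleP n d k s :
  let nd := (n * d)%N in let kd := (k * d)%N in
  let db := (nd + (kd + d) + (kd + d) + (kd + d) + (kd + d))%N in
  let D p := rmem s (db + p)%N in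
  (0 < n)%N -> env n d k nd kd s ->
  runs sample s (15 * n + 7 * d + 16) (fun s' => forall y, rmem s' y =
    if (nd + kd <= y < nd + kd + d)%N then
      rmem s (pick_index D (tape s 0 * \sum_(0 <= p < n) D p) n * d + (y - (nd + kd)))%N
    else rmem s y).
Proof.
move=> nd kd db D n0 e; set r := tape s 0 * _.
apply: (@runs_time _ ((6 * n + 3) + (6 + ((9 * n + 2) + (3 + (7 * d + 2)))))); first by lia.
apply: runs_seq; apply: runs_frame.
apply: runs_conseq (total_distP e) => s1 S1 f1.
have e1 := env_frame f1 e isT.
apply: runs_seq; apply: runs_block => //=; rewrite /upd /=; set s2 := set_ireg _ _ _.
have rm1 : rmem s1 = rmem s by rewrite (fr_rm f1).
have e2 : env n d k nd kd s2 by case: e1 => *; split.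
apply: runs_seq; apply: runs_frame.
apply: runs_conseq (pick_pointP (r := r) e2 _ _ _ _) => //; last first.
  by rewrite /= /upd /= S1 (fr_t f1).
rewrite /s2 /= rm1 => s3 E3 f3.
have e3 := env_frame f3 e2 isT.
apply: runs_seq; apply: runs_block => //=; rewrite /upd /=; set s4 := set_ireg _ _ _.
have rm3 : rmem s3 = rmem s by rewrite (fr_rm f3) // -rm1.
have := pick_index_lt D r n0; set p := pick_index D r n => pn.
apply: runs_conseq (copyP (src := (p * d)%N) (dst := (nd + kd)%N) (N := d) _ _ _ _ _);
  rewrite /s4 //= /upd /= ?(e_one e3) ?(e_nd e3) ?(e_kd e3) ?(e_d e3) //.
- by move=> s5 H y; rewrite H rm3.
- suff : (p * d + d <= nd)%N by lia.
  by rewrite addnC -mulSn leq_mul2r pn orbT.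
Qed.
End SetupAndSampling.

(** * Sums, means and cost of one candidate, at the level of cells *)

Section Candidate.
Variable R : realType.
Implicit Types s : state R.

Lemma zero_sumsP n d k nd kd s :
  let wb := (nd + (kd + d))%N in
  env n d k nd kd s ->
  runs zero_sums s (10 * (kd + d) + 5) (fun s' => rreg s' xZero = 0 /\
    forall y, rmem s' y = if (wb <= y < wb + (kd + d) + (kd + d))%N then 0 else rmem s y).
Proof.
move=> wb e.
apply: (@runs_time _ (3 + ((kd + d + (kd + d)) * (3 + 2) + 2))); first by lia.
apply: runs_seq; apply: runs_block => //=; rewrite /upd /=; set si := set_rreg _ _ _.
have ei : env n d k nd kd si by case: (e) => *; split.
apply: runs_conseq (runs_loop (N := (kd + d + (kd + d))%N) (I := fun m s' =>
  rreg s' xZero = 0 /\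
  forall y, rmem s' y = if (wb <= y < wb + m)%N then 0 else rmem s y) _ _ _ _ _ _) => //=.
- by move=> s' [z H]; split=> // y; rewrite H !addnA.
- exact: e_one e.
- by rewrite /upd /= (e_kd1 e).
- by split=> // y; case: ifP => //; lia.
move=> m s0 mN sm f [z H]; apply: runs_block => //=; rewrite /upd /=.
have e0 := env_frame f ei isT.
rewrite (e_wb e0) sm z; split=> // y; rewrite H.
by do !case: ifP => //; lia.
Qed.

Definition target (M : nat -> nat) (nd i x : nat) : nat :=
  if M (nd + x)%N == i then M (nd + nd + x)%N else M x.

Definition cell_sum (M : nat -> R) (psi : nat -> nat) (m z : nat) : R :=
  \sum_(0 <= x < m) (if psi x == z then M x else 0).

Definition cell_count (psi : nat -> nat) (m z : nat) : R :=
  \sum_(0 <= x < m) (if psi x == z then 1 else 0).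

Definition cell_mean (M : nat -> R) (psi : nat -> nat) (nd z : nat) : R :=
  if cell_count psi nd z == 0 then M (nd + z)%N
  else cell_sum M psi nd z / cell_count psi nd z.

Lemma add_sumsP n d k nd kd s i (M : nat -> R) :
  let wb := (nd + (kd + d))%N in let cb := (wb + (kd + d))%N in
  let bb := (cb + (kd + d))%N in
  let psi := target (imem s) nd i in
  env n d k nd kd s -> ireg s iI = i ->
  (forall x, (x < nd)%N -> (psi x < kd + d)%N) ->
  (forall y, rmem s y = if (wb <= y < bb)%N then 0 else M y) ->
  runs add_sums s (21 * nd + 3) (fun s' =>
    [/\ forall y, imem s' y =
          if (nd + nd + nd <= y < nd + nd + nd + nd)%N
          then psi (y - (nd + nd + nd))%N else imem s y,
        forall z, (z < kd + d)%N -> rmem s' (wb + z)%N = cell_sum M psi nd z,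
        forall z, (z < kd + d)%N -> rmem s' (cb + z)%N = cell_count psi nd z &
        forall y, (y < wb)%N || (bb <= y)%N -> rmem s' y = M y]).
Proof.
move=> wb cb bb psi e sI psi_lt rm0.
apply: (@runs_time _ (1 + (nd * (3 + (4 + 12) + 2) + 2))); first by lia.
apply: runs_seq; apply: runs_instr => //=; set si := set_rreg _ _ _.
have ei : env n d k nd kd si by case: (e) => *; split.
apply: runs_conseq (runs_loop (N := nd) (I := fun m s' =>
  [/\ forall y, imem s' y =
          if (nd + nd + nd <= y < nd + nd + nd + m)%N
          then psi (y - (nd + nd + nd))%N else imem s y,
        forall z, (z < kd + d)%N -> rmem s' (wb + z)%N = cell_sum M psi m z,
        forall z, (z < kd + d)%N -> rmem s' (cb + z)%N = cell_count psi m z &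
        forall y, (y < wb)%N || (bb <= y)%N -> rmem s' y = M y])
  _ _ _ _ _ _) => //=.
- exact: e_one e.
- exact: e_nd e.
- split=> [y|z zk|z zk|y yb]; rewrite ?rm0.
  + by case: ifP => //; lia.
  + by rewrite ifT /cell_sum ?big_nil // /bb /cb; lia.
  + by rewrite ifT /cell_count ?big_nil // /bb /cb; lia.
  + by rewrite ifF //; lia.
move=> m s0 mN sm f [H1 H2 H3 H4].
have e0 := env_frame f ei isT.
have i0 : ireg s0 iI = i by rewrite (fr_i f).
have one0 : rreg s0 xOne = 1 by rewrite (fr_r f).
apply: runs_seq; apply: runs_block => //=; rewrite /upd /= (e_nd e0) sm; set s1 := set_ireg _ _ _.
apply: runs_seq; apply: runs_frame.
apply: (@runs_conseq _ (fun s' => ireg s' iU = psi m)) => [s2 U2 f2|]; last first.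
  (* The loop stores only in the fourth block, so the three label blocks behind [psi] keep their
     initial contents. *)
  have mem_nd y : (y < nd + nd + nd)%N -> imem s0 y = imem s y.
    by move=> h; rewrite H1 ifF //; lia.
  apply: runs_if; rewrite /= /upd /= i0 (mem_nd (nd + m)%N); do ?[lia] => h.
    apply: runs_block => //=; rewrite /upd /= (e_nd e0) /psi /target h mem_nd; last by lia.
    by congr (imem _ _); lia.
  apply: (@runs_time _ 1) => //; apply: runs_instr => //=.
  by rewrite /upd /= sm /psi /target (negPf h) mem_nd //; lia.
have r2 x : rreg s2 x = rreg s0 x by rewrite (fr_r f2).
have rm2 : rmem s2 = rmem s0 by rewrite (fr_rm f2).
have im2 : imem s2 = imem s0 by rewrite (fr_im f2).
have d3 : ireg s2 iND3 = (nd + nd + nd)%N by rewrite (fr_i f2) //; exact: e_nd3 e0.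
have dw : ireg s2 iWb = wb by rewrite (fr_i f2) //; exact: e_wb e0.
have dc : ireg s2 iCb = cb by rewrite (fr_i f2) //; exact: e_cb e0.
have dx : ireg s2 iX = m by rewrite (fr_i f2).
apply: runs_block => //=; rewrite /upd /= U2 r2 rm2 im2 d3 dw dc dx one0.
have pk := psi_lt _ mN.
split=> [y|z zk|z zk|y yb].
- rewrite H1; have [->|/eqP ym] := eqVneq y (nd + nd + nd + m)%N.
    by rewrite ifT ?addKn //; lia.
  by do !case: ifP => //; lia.
- rewrite ifF /cb; last by lia.
  rewrite /cell_sum big_nat_recr //= -/(cell_sum M psi m z) -(H2 _ zk) eqn_add2l.
  rewrite [z == _]eq_sym; case: eqP => [->|_]; last by rewrite addr0.
  by rewrite (H4 m) // /wb; lia.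
- rewrite eqn_add2l /cell_count big_nat_recr //= -/(cell_count psi m z) -(H3 _ zk).
  rewrite [z == _]eq_sym; case: eqP => [->|_].
    by rewrite ifF // /cb; lia.
  by rewrite addr0 ifF // /cb; lia.
- by rewrite !ifF ?H4 // /cb; lia.
Qed.

Lemma divide_sumsP n d k nd kd s (M : nat -> R) psi :
  let wb := (nd + (kd + d))%N in let cb := (wb + (kd + d))%N in
  let bb := (cb + (kd + d))%N in
  env n d k nd kd s -> rreg s xZero = 0 ->
  (forall z, (z < kd + d)%N -> rmem s (wb + z)%N = cell_sum M psi nd z) ->
  (forall z, (z < kd + d)%N -> rmem s (cb + z)%N = cell_count psi nd z) ->
  (forall y, (y < wb)%N || (bb <= y)%N -> rmem s y = M y) ->
  runs divide_sums s (11 * (kd + d) + 2) (fun s' =>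
    (forall z, (z < kd + d)%N -> rmem s' (wb + z)%N = cell_mean M psi nd z) /\
    (forall y, (y < wb)%N || (bb <= y)%N -> rmem s' y = M y)).
Proof.
move=> wb cb bb e z0 rW rC rM.
apply: (@runs_time _ ((kd + d) * (4 + (4 + 1) + 2) + 2)); first by lia.
apply: runs_conseq (runs_loop (N := (kd + d)%N) (I := fun m s' =>
  [/\ forall z, (z < m)%N -> rmem s' (wb + z)%N = cell_mean M psi nd z,
      forall z, (m <= z < kd + d)%N -> rmem s' (wb + z)%N = cell_sum M psi nd z
    & forall y, (y < wb)%N || (cb <= y)%N -> rmem s' y = rmem s y])
  _ _ _ _ _ _) => //=.
- move=> s' [H1 H2 H3]; split=> // y yb; rewrite H3 ?rM //.
  by rewrite /bb /cb in yb *; lia.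
- exact: e_one e.
- exact: e_kd1 e.
move=> m s0 mN sm f [H1 H2 H3].
have e0 := env_frame f e isT.
have z00 : rreg s0 xZero = 0 by rewrite (fr_r f).
apply: runs_seq; apply: runs_block => //=; rewrite /upd /= (e_cb e0) (e_wb e0) sm.
set s1 := set_ireg _ _ _.
have cm : rmem s0 (cb + m)%N = cell_count psi nd m.
  by rewrite H3 ?rC // /cb; lia.
apply: runs_seq; apply: runs_frame.
apply: (@runs_conseq _ (fun s' => rreg s' x0 = cell_mean M psi nd m)) => [s2 E2 f2|]; last first.
  apply: runs_if; rewrite /= /upd /= z00 cm => h.
    apply: runs_block => //=; rewrite /upd /= (e_nd e0) sm /cell_mean h H3 ?rM //; rewrite /wb; lia.
  apply: runs_block => //=; rewrite /upd /= cm (negPf h) /= /cell_mean (negPf h).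
  by rewrite H2 //; lia.
apply: runs_instr => //=; rewrite /upd /= E2.
have -> : ireg s2 iU = (wb + m)%N by rewrite (fr_i f2).
have -> : rmem s2 = rmem s0 by rewrite (fr_rm f2).
split=> [z|z|y yb].
- rewrite ltnS leq_eqVlt => /predU1P[->|zm]; first by rewrite eqxx.
  by rewrite ifF ?H1 //; lia.
- by move=> zm; rewrite ifF ?H2 //; lia.
- by rewrite ifF ?H3 //; rewrite /cb in yb *; lia.
Qed.

Lemma cost_progP n d k nd kd s (M W : nat -> R) (psi : nat -> nat) :
  let wb := (nd + (kd + d))%N in
  env n d k nd kd s ->
  (forall x, (x < nd)%N -> (psi x < kd + d)%N) ->
  (forall x, (x < nd)%N -> imem s (nd + nd + nd + x)%N = psi x) ->
  (forall z, (z < kd + d)%N -> rmem s (wb + z)%N = W z) ->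
  (forall y, (y < nd)%N -> rmem s y = M y) ->
  runs cost_prog s (11 * nd + 3) (fun s' =>
    rreg s' xC = \sum_(0 <= x < nd) (M x - W (psi x)) ^+ 2).
Proof.
move=> wb e psi_lt im rW rM.
apply: (@runs_time _ (1 + (nd * (9 + 2) + 2))); first by lia.
apply: runs_seq; apply: runs_instr => //=; set si := set_rreg _ _ _.
have ei : env n d k nd kd si by case: (e) => *; split.
apply: (runs_loop (N := nd) (I := fun m s' =>
  rreg s' xC = \sum_(0 <= x < m) (M x - W (psi x)) ^+ 2)) => //=.
- exact: e_one e.
- exact: e_nd e.
- by rewrite big_nil.
move=> m s0 mN sm f H.
have e0 := env_frame f ei isT.
apply: runs_block => //=; rewrite /upd /= (e_nd3 e0) (e_wb e0) sm (fr_im f) // (fr_rm f) //=.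
by rewrite im // rW ?psi_lt // rM // H big_nat_recr.
Qed.

Lemma candidateP n d k nd kd s i io :
  let wb := (nd + (kd + d))%N in
  let bb := (wb + (kd + d) + (kd + d))%N in
  let psi := target (imem s) nd i in
  let W := cell_mean (rmem s) psi nd in
  env n d k nd kd s -> ireg s iI = i -> ireg s iIO = io -> (io <= kd)%N ->
  (forall x, (x < nd)%N -> (psi x < kd + d)%N) ->
  runs candidate s (32 * nd + 21 * (kd + d) + 7 * d + 20) (fun s' =>
    [/\ rreg s' xC = \sum_(0 <= x < nd) (rmem s x - W (psi x)) ^+ 2,
        forall z, (z < kd + d)%N -> rmem s' (wb + z)%N =
          if (io <= z < io + d)%N then W (kd + (z - io))%N else W z,
        forall y, (y < wb)%N || (bb <= y)%N -> rmem s' y = rmem s y &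
        forall y, (y < nd + nd + nd)%N -> imem s' y = imem s y]).
Proof.
move=> wb bb psi W e sI sIO iok psi_lt.
apply: (@runs_time _ ((10 * (kd + d) + 5) + ((21 * nd + 3) +
  ((11 * (kd + d) + 2) + ((11 * nd + 3) + (4 + (7 * d + 2))))))); first by lia.
apply: runs_seq; apply: runs_frame.
apply: runs_conseq (zero_sumsP e) => s1 [z1 H1] f1.
have e1 := env_frame f1 e isT.
have im1 : imem s1 = imem s by rewrite (fr_im f1).
apply: runs_seq; apply: runs_frame.
apply: runs_conseq (add_sumsP (i := i) (M := rmem s) e1 _ _ _) => //;
  rewrite ?im1 //; last by rewrite (fr_i f1).
move=> s2 [I2 W2 C2 M2] f2.
have e2 := env_frame f2 e1 isT.
apply: runs_seq; apply: runs_frame.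
apply: runs_conseq (divide_sumsP e2 _ W2 C2 M2); last by rewrite (fr_r f2).
move=> s3 [W3 M3] f3.
have e3 := env_frame f3 e2 isT.
apply: runs_seq; apply: runs_frame.
apply: runs_conseq (cost_progP (M := rmem s) e3 psi_lt _ W3 _); last 2 first.
- by move=> x xn; rewrite (fr_im f3) // I2 ifT ?addKn //; lia.
- by move=> y yn; rewrite M3 //; lia.
move=> s4 C4 f4.
have e4 := env_frame f4 e3 isT.
apply: runs_seq; apply: runs_block => //=; rewrite /upd /=; set s5 := set_ireg _ _ _.
have io4 : ireg s4 iIO = io by rewrite (fr_i f4) // (fr_i f3) // (fr_i f2) // (fr_i f1).
have rm4 : rmem s4 = rmem s3 by rewrite (fr_rm f4).
apply: runs_frame.
apply: runs_conseq (copyP (src := (wb + kd)%N) (dst := (wb + io)%N) (N := d) _ _ _ _ _);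
  rewrite /s5 //= /upd /= ?io4 ?(e_one e4) ?(e_wb e4) ?(e_kd e4) ?(e_d e4) //; last by lia.
move=> s6 H6 f6; split.
- by rewrite (fr_r f6).
- move=> z zk; rewrite H6 rm4 -addnA leq_add2l ltn_add2l.
  case: ifP => h; rewrite /W -W3 //; last by lia.
  by congr (rmem s3 _); lia.
- by move=> y yb; rewrite H6 ifF ?rm4 ?M3 //; rewrite /bb in yb; lia.
- move=> y yn; rewrite (fr_im f6) //= (fr_im f4) // (fr_im f3) // I2.
  by rewrite ifF //; lia.
Qed.

End Candidate.

(** * From memory cells to points and centers *)

Lemma eq_cell (d l l' j j' : nat) : (j < d)%N -> (j' < d)%N ->
  (l * d + j == l' * d + j')%N = (l == l') && (j == j').
Proof.
move=> jd jd'; apply/eqP/andP => [E|[/eqP-> /eqP->]//].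
have d0 : (0 < d)%N by lia.
have := congr1 (divn^~ d) E; rewrite !divnMDl // !divn_small // !addn0 => El.
by move: E; rewrite El => /addnI ->; rewrite !eqxx.
Qed.

Lemma sum_cells (V : nmodType) (n d : nat) (F : nat -> V) :
  \sum_(0 <= x < n * d) F x = \sum_(p < n) \sum_(j < d) F (p * d + j)%N.
Proof.
elim: n => [|n IH]; first by rewrite mul0n big_nil big_ord0.
rewrite big_ord_recr /= -IH mulSnr (@big_cat_nat _ _ _ (n * d)) ?leq_addr //=.
congr (_ + _); rewrite -{1}(add0n (n * d)%N) big_addn addKn big_mkord.
by apply: eq_bigr => j _; rewrite addnC.
Qed.

Section Geometry.
Variables (R : realType) (n d : nat).
Implicit Types (P : 'I_n -> 'rV[R]_d) (M : nat -> R).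

Lemma l2norm_sq (x : 'rV[R]_d) : l2norm x ^+ 2 = \sum_(j < d) x 0 j ^+ 2.
Proof. by rewrite sqr_sqrtr // sumr_ge0 // => j _; exact: sqr_ge0. Qed.

Lemma ler_l2norm (x y : 'rV[R]_d) :
  (l2norm x <= l2norm y) = (l2norm x ^+ 2 <= l2norm y ^+ 2).
Proof. by rewrite ler_pXn2r // nnegrE sqrtr_ge0. Qed.

Definition holds_points m (M : nat -> R) (b : nat) (E : 'I_m -> 'rV[R]_d) :=
  forall (l : 'I_m) (j : 'I_d), M (b + l * d + j)%N = E l 0 j.

Lemma sqdistE m P (E : 'I_m -> 'rV[R]_d) M b (p : 'I_n) (l : 'I_m) :
  holds_points M 0 P -> holds_points M b E ->
  sqdist M d (p * d) (b + l * d) = l2norm (P p - E l) ^+ 2.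
Proof.
move=> MP ME; have MP0 (p' : 'I_n) (j : 'I_d) : M (p' * d + j)%N = P p' 0 j by exact: MP.
rewrite /sqdist big_mkord l2norm_sq; apply: eq_bigr => j _.
by rewrite (MP0 p j) ME !mxE.
Qed.

Variables (m : nat) (P : 'I_n -> 'rV[R]_d) (E : 'I_m -> 'rV[R]_d).
Variables (M : nat -> R) (lab : 'I_n -> 'I_m) (psi : nat -> nat).
Hypothesis MP : holds_points M 0 P.
Hypothesis ME : holds_points M (n * d) E.
Hypothesis psiE : forall (p : 'I_n) (j : 'I_d),
  psi (p * d + j)%N = (lab p * d + j)%N.

Let MP0 (p : 'I_n) (j : 'I_d) : M (p * d + j)%N = P p 0 j. Proof. exact: MP. Qed.

(** As [psi] preserves coordinates, only the [j]-th of the [d] cells of a point can be mapped to the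
    [j]-th cell of a center. *)
Lemma cell_sumE (l : 'I_m) (j : 'I_d) :
  cell_sum M psi (n * d) (l * d + j) = \sum_(p in Defs.cluster lab l) P p 0 j.
Proof.
rewrite /cell_sum sum_cells [RHS]big_mkcond /=; apply: eq_bigr => p _.
rewrite /Defs.cluster inE (bigD1 j) //= psiE eq_cell // eqxx andbT.
rewrite big1 ?addr0; first by rewrite val_eqE (MP0 p j).
move=> j' j'j; rewrite psiE eq_cell //.
by rewrite [(_ : nat) == j]val_eqE (negPf j'j) andbF.
Qed.

Lemma cell_countE (l : 'I_m) (j : 'I_d) :
  cell_count R psi (n * d) (l * d + j) = #|Defs.cluster lab l|%:R.
Proof.
rewrite -sum1_card natr_sum /cell_count sum_cells [RHS]big_mkcond /=.
apply: eq_bigr => p _.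
rewrite /Defs.cluster inE (bigD1 j) //= psiE eq_cell // eqxx andbT.
rewrite big1 ?addr0; first by rewrite val_eqE.
move=> j' j'j; rewrite psiE eq_cell //.
by rewrite [(_ : nat) == j]val_eqE (negPf j'j) andbF.
Qed.

Lemma cell_meanE (l : 'I_m) (j : 'I_d) :
  cell_mean M psi (n * d) (l * d + j) = lloyd_centers P E lab l 0 j.
Proof.
rewrite /cell_mean /lloyd_centers cell_countE cell_sumE pnatr_eq0 cards_eq0.
by case: ifP => _; [rewrite addnA ME|rewrite !mxE summxE mulrC].
Qed.

Lemma cell_costE :
  \sum_(0 <= x < n * d) (M x - cell_mean M psi (n * d) (psi x)) ^+ 2 =
  Phi_assign P (lloyd_centers P E lab) lab.
Proof.
rewrite sum_cells; apply: eq_bigr => p _; rewrite l2norm_sq.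
apply: eq_bigr => j _.
by rewrite psiE cell_meanE (MP0 p j) !mxE.
Qed.

End Geometry.

(** The bridge from [k.+1] labels to a family of [k] centers: along an injection whose image
    contains all labels in use, clusters and hence means and cost are the same. Closeness of [lab]
    is required only against the centers in the image, which is what leaving out a label allows. *)
Lemma lloyd_relabel (R : realType) (n d k m : nat) (P : 'I_n -> 'rV[R]_d)
    (E : 'I_m -> 'rV[R]_d) (h : 'I_k -> 'I_m) (lab : 'I_n -> 'I_m)
    (phi : 'I_n -> 'I_k) (W := lloyd_centers P E lab) :
  injective h -> (forall p, h (phi p) = lab p) ->
  (forall p j, l2norm (P p - E (lab p)) <= l2norm (P p - E (h j))) ->
  lloyd P (E \o h) (W \o h, phi) /\ Phi_assign P (W \o h) phi = Phi_assign P W lab.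
Proof.
move=> injh hphi cl; split; last by apply: eq_bigr => p _; rewrite /= hphi.
split=> [p j|]; first by rewrite /= hphi.
apply/funext => j; rewrite /= /W /lloyd_centers.
suff -> : Defs.cluster lab (h j) = Defs.cluster phi j by [].
by apply/setP => p; rewrite !inE -hphi (inj_eq injh).
Qed.

Definition ext (R : realType) (d k : nat) (C : 'I_k -> 'rV[R]_d)
  (c : 'rV[R]_d) (l : 'I_k.+1) : 'rV[R]_d := oapp C c (insub (l : nat)).

(* Label [k] (that is, [c_new]) takes over position [i]; for [i = k] this is
   the inclusion of the labels of [C]. *)
Definition take_over (k : nat) (i : 'I_k.+1) (j : 'I_k) : 'I_k.+1 :=
  if j == i :> nat then ord_max else widen_ord (leqnSn k) j.

Lemma take_over_inj k (i : 'I_k.+1) : injective (take_over i).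
Proof.
move=> j j'; rewrite /take_over => H; apply: val_inj => /=.
by move: H; do 2!case: eqP => [->|?] //; move/(congr1 val) => /=; have := ltn_ord j;
  have := ltn_ord j'; lia.
Qed.

Lemma take_over_neq k (i : 'I_k.+1) j : take_over i j != i.
Proof.
suff H : take_over i j <> i by apply/negP => /eqP.
rewrite /take_over; case: eqP => ji E; have := congr1 val E => //=.
by have := ltn_ord j; lia.
Qed.

(** Lets a labelling that avoids [i] be read as an assignment to positions in ['I_k]. *)
Lemma take_over_onto k (i l : 'I_k.+1) : l != i -> exists j, take_over i j = l.
Proof.
move=> li; have lin : ((l : nat) == i) = false.
  by apply/eqP => E; case/eqP: li; exact: val_inj.
case: (ltnP l k) => lk.
  by exists (Ordinal lk); rewrite /take_over /= lin; exact: val_inj.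
have ik : (i < k)%N.
  by move/eqP: lin; have := ltn_ord i; have := ltn_ord l; lia.
exists (Ordinal ik); rewrite /take_over eqxx; apply: val_inj => /=.
by have := ltn_ord l; lia.
Qed.

Lemma ext_swap (R : realType) d k (C : 'I_k -> 'rV[R]_d) c (i : 'I_k) :
  ext C c \o take_over (widen_ord (leqnSn k) i) = swap C i c.
Proof.
apply/funext => j; rewrite /= /take_over /swap /ext /= -(inj_eq val_inj) /=.
case: eqP => _ /=; first by rewrite insubF // ltnn.
by rewrite valK.
Qed.

Lemma ext_keep (R : realType) d k (C : 'I_k -> 'rV[R]_d) c :
  ext C c \o take_over ord_max = C.
Proof.
apply/funext => j; rewrite /= /take_over /ext ifF /=; first by rewrite valK.
by rewrite ltn_eqF.
Qed.

(** * The search over all candidates and the whole iteration *)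

Definition keep := Seq
  (block [:: RMove xBest xC; IMove iSrc iWb; IMove iDst iBb; IMove iLen iKD])
  copy.

(** The first candidate leaves out label [k], which is step (b). The old centers are overwritten
    only by the last copy, because every candidate reads them again for its empty clusters. *)
Definition search := Seq (block [:: IMove iI iK; IMove iIO iKD])
  (Seq candidate (Seq keep (Seq (Instr (IConst iIO 0))
  (Seq (loop iI iK (Seq candidate (Seq (If (RLt xC xBest) keep Skip)
                                       (Instr (IAdd iIO iIO iD)))))
  (Seq (block [:: IMove iSrc iBb; IMove iDst iND; IMove iLen iKD]) copy))))).

(** Repeating the first center in slot [k] does not change the distance to the nearest center, so
    one routine for [k.+1] centers serves both before and after the sampling. *)
Definition foresight := Seq setup
  (Seq (block [:: IMove iSrc iND; IAdd iDst iND iKD; IMove iLen iD])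
  (Seq copy (Seq nearest_two (Seq sample (Seq nearest_two search))))).

Lemma cell_lt m d (l : 'I_m) (j : 'I_d) : (l * d + j < m * d)%N.
Proof.
have : (l.+1 * d <= m * d)%N by rewrite leq_mul2r ltn_ord orbT.
by rewrite mulSnr; have := ltn_ord j; lia.
Qed.

Lemma holds_points_eq (R : realType) m d (M M' : nat -> R) base (Q : 'I_m -> 'rV[R]_d) :
  holds_points M base Q ->
  (forall y, (base <= y < base + m * d)%N -> M' y = M y) ->
  holds_points M' base Q.
Proof.
move=> H E l j; rewrite E ?H // -addnA.
by have := cell_lt l j; lia.
Qed.

(** * Specifications of the programs in terms of points and centers *)

Section Specification.
Variables (R : realType) (n d k : nat) (P : 'I_n -> 'rV[R]_d).
Implicit Types (s : state R) (C : 'I_k -> 'rV[R]_d) (E : 'I_k.+1 -> 'rV[R]_d).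
Implicit Types (a b : 'I_n -> 'I_k.+1).

Let nd := (n * d)%N.
Let kd := (k * d)%N.
Let wb := (nd + (kd + d))%N.
Let bb := (wb + (kd + d) + (kd + d))%N.
Let db := (bb + (kd + d))%N.

(** [b p] is second as a label: with ties or repeated centers, both distances may coincide. *)
Record two_nearest E a b : Prop := TwoNearest {
  tn_first : forall p l, l2norm (P p - E (a p)) <= l2norm (P p - E l);
  tn_neq : forall p, b p != a p;
  tn_second : forall p l, l != a p -> l2norm (P p - E (b p)) <= l2norm (P p - E l) }.

Record labelled E a b s : Prop := Labelled {
  lb_env : env n d k nd kd s;
  lb_P : holds_points (rmem s) 0 P;
  lb_E : holds_points (rmem s) nd E;
  lb_im : forall (p : 'I_n) (j : 'I_d),
    labels_at (imem s) nd (p * d) (a p) (a p * d) (b p * d) j }.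

Lemma holds_ext C (c : 'rV[R]_d) M : holds_points M nd C ->
  (forall j : 'I_d, M (nd + kd + j)%N = c 0 j) -> holds_points M nd (ext C c).
Proof.
move=> MC Mc l j; rewrite /ext; case: insubP => [i _ <-|] /=; first exact: MC.
rewrite -leqNgt => kl; have -> : (l : nat) = k by have := ltn_ord l; lia.
exact: Mc.
Qed.

Lemma labelled_frame E a b c s s' : labelled E a b s -> frame c s s' ->
  all (leq 15) (writes iwr c) ->
  (forall y, (y < wb)%N -> rmem s' y = rmem s y) ->
  (forall y, (y < nd + nd + nd)%N -> imem s' y = imem s y) ->
  labelled E a b s'.
Proof.
move=> [e HP HE H] f w rm im; split.
- exact: env_frame f e w.
- by apply: holds_points_eq HP _ => y yn; rewrite rm // /wb /nd; lia.
- apply: holds_points_eq HE _ => y; rewrite mulSnr => yn; rewrite rm // /wb /kd; lia.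
- move=> p j; have := cell_lt p j; rewrite -/nd => lt.
  by have [h1 h2 h3] := H p j; split; rewrite im //; lia.
Qed.

Lemma labelled_set_ireg E a b s r v : (15 <= r)%N -> labelled E a b s ->
  labelled E a b (set_ireg s r v).
Proof.
move=> r15 lb; have f : frame (Instr (IConst r v)) s (set_ireg s r v).
  by apply: exec_frame; exact: ExecInstr.
by apply: (labelled_frame lb f) => //=; rewrite andbT.
Qed.

Lemma nearest_two_spec E s : (0 < k)%N -> env n d k nd kd s ->
  holds_points (rmem s) 0 P -> holds_points (rmem s) nd E ->
  runs nearest_two s (n * (k.+1 * (10 * d + 17) + 11 * d + 15) + 3) (fun s' =>
    exists a b, [/\ two_nearest E a b, labelled E a b s',
      forall p : 'I_n, rmem s' (db + p)%N = l2norm (P p - E (a p)) ^+ 2 &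
      forall y, (y < db)%N -> rmem s' y = rmem s y]).
Proof.
move=> k0 e HP HE; apply: runs_frame; apply: runs_conseq (nearest_twoP e) => s' [H rm] f.
pose D (p l : nat) := sqdist (rmem s) d (p * d) (nd + l * d).
have DE (p : 'I_n) (l : 'I_k.+1) : D p l = l2norm (P p - E l) ^+ 2.
  exact: sqdistE HP HE.
pose a (p : 'I_n) : 'I_k.+1 := inord (top2 (D p) k.+1).1.
pose b (p : 'I_n) : 'I_k.+1 := inord (top2 (D p) k.+1).2.
have spec (p : 'I_n) : [/\ top2 (D p) k.+1 = (a p : nat, b p : nat),
    forall l, D p (a p) <= D p (l : 'I_k.+1), b p != a p &
    forall l, l != a p -> D p (b p) <= D p (l : 'I_k.+1)].
  rewrite /a /b; case T: (top2 (D p) k.+1) => [a0 b0] /=.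
  (* [k0] is [1 < k.+1], so the second label is genuine. *)
  have [/(_ isT)[a_lt a_le] /(_ k0)[b_lt ba b_le]] := top2P T.
  rewrite !inordK //; split=> // [l||l la]; first exact: a_le.
    by apply: contra ba => /eqP/(congr1 val) /=; rewrite !inordK // => ->.
  apply: b_le => //; apply: contra la => /eqP la; apply/eqP/val_inj.
  by rewrite /= inordK.
have H' (p : 'I_n) : rmem s' (db + p)%N = D p (a p) /\ forall j, (j < d)%N ->
    labels_at (imem s') nd (p * d) (a p) (a p * d) (b p * d) j.
  by have := H p (ltn_ord p); have [T _ _ _] := spec p; rewrite /= -/(D p) T.
exists a, b; split=> //.
- split=> [p l|p|p l la]; have [_ h1 h2 h3] := spec p; rewrite // ler_l2norm -!DE.
    exact: h1.
  exact: h3.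
- split.
  + exact: env_frame f e isT.
  + by apply: holds_points_eq HP _ => y yn; rewrite rm // /nd; lia.
  + by apply: holds_points_eq HE _ => y; rewrite mulSnr => yn; rewrite rm // /kd; lia.
  + by move=> p j; have [_] := H' p; exact.
- by move=> p; have [+ _] := H' p; rewrite DE.
Qed.

Lemma candidate_spec E a b s (i : 'I_k.+1) :
  two_nearest E a b -> labelled E a b s ->
  ireg s iI = i -> ireg s iIO = (i * d)%N ->
  runs candidate s (32 * nd + 21 * (kd + d) + 7 * d + 20) (fun s' =>
    exists out, [/\ lloyd P (E \o take_over i) out,
      rreg s' xC = Phi_assign P out.1 out.2,
      holds_points (rmem s') wb out.1, labelled E a b s' &
      forall y, (bb <= y)%N -> rmem s' y = rmem s y]).
Proof.
move=> tn lb sI sIO.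
pose lab p := if a p == i then b p else a p.
pose psi := target (imem s) nd i.
have psiE (p : 'I_n) (j : 'I_d) : psi (p * d + j)%N = (lab p * d + j)%N.
  rewrite /psi /target /lab; have [-> -> ->] := lb_im lb p j.
  by rewrite -(inj_eq val_inj); case: ifP.
have psi_lt x : (x < nd)%N -> (psi x < kd + d)%N.
  move=> xn; have d0 : (0 < d)%N by move: xn; rewrite /nd; case: (d) => //; lia.
  have xp : (x %/ d < n)%N by rewrite ltn_divLR.
  rewrite {1}(divn_eq x d) (psiE (Ordinal xp) (Ordinal (ltn_pmod x d0))) /=.
  by have := cell_lt (lab (Ordinal xp)) (Ordinal (ltn_pmod x d0)); rewrite mulSnr.
have iok : (i * d <= kd)%N by rewrite leq_mul2r -ltnS ltn_ord orbT.
apply: runs_frame.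
apply: runs_conseq (candidateP (lb_env lb) sI sIO iok psi_lt) => s' [cost W rm im] f.
have labi p : lab p != i.
  rewrite /lab; case: ifPn => // /eqP <-; exact: tn_neq tn p.
(* No point carries label [i], so [lab] factors through [take_over i]. *)
have [phi phiE] := choice (fun p => take_over_onto (labi p)).
pose Wc := lloyd_centers P E lab.
have cl p j : l2norm (P p - E (lab p)) <= l2norm (P p - E (take_over i j)).
  rewrite /lab; case: ifPn => [/eqP ai|_]; last exact: tn_first tn _ _.
  by apply: (tn_second tn); rewrite ai take_over_neq.
have [ll cE] := lloyd_relabel (@take_over_inj k i) phiE cl.
exists (Wc \o take_over i, phi); split=> //=.
- by rewrite cost cE -(cell_costE (lb_P lb) (lb_E lb) psiE).
- move=> l j; rewrite -addnA W; last first.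
    by have := cell_lt l j; rewrite -/kd; lia.
  (* Position [i] holds the mean of label [k], moved there by the final copy. A cell of any other
     position lies outside the overwritten block, as division by [d] shows. *)
  rewrite -(cell_meanE (lb_P lb) (lb_E lb) psiE) -/nd -/psi /take_over.
  case: eqP => [li|/eqP li] /=.
    rewrite ifT; last by rewrite li; have := ltn_ord j; lia.
    by congr (cell_mean _ _ _ _); rewrite li addKn.
  rewrite ifF //; apply/negP => h; case/eqP: li.
  have d0 : (0 < d)%N by apply: leq_ltn_trans (ltn_ord j).
  have : ((l * d + j) %/ d)%N = i.
    have -> : (l * d + j = i * d + (l * d + j - i * d))%N by lia.
    by rewrite divnMDl // divn_small ?addn0 //; lia.
  by rewrite divnMDl // divn_small ?addn0 // ltn_ord.
- by apply: labelled_frame lb f isT _ im => y yw; rewrite rm // yw.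
- by move=> y yb; rewrite rm // -/nd -/kd -/wb -/bb yb orbT.
Qed.

Lemma keepP E a b s (C : 'I_k -> 'rV[R]_d) :
  labelled E a b s -> holds_points (rmem s) wb C ->
  runs keep s (7 * kd + 7) (fun s' => [/\ rreg s' xBest = rreg s xC,
    holds_points (rmem s') bb C & labelled E a b s']).
Proof.
move=> lb HC; have e := lb_env lb; apply: runs_frame.
apply: (@runs_time _ (5 + (7 * kd + 2))); first by lia.
apply: runs_seq; apply: runs_block => //=; rewrite /upd /=; set s1 := set_ireg _ _ _.
apply: runs_frame.
apply: runs_conseq (copyP (src := wb) (dst := bb) (N := kd) _ _ _ _ _);
  rewrite /s1 //= /upd /= ?(e_one e) ?(e_wb e) ?(e_bb e) ?(e_kd e) //; last by rewrite /bb; lia.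
move=> s2 H f2 f; split.
- by rewrite (fr_r f2).
- move=> l j; rewrite H -addnA; have := cell_lt l j; rewrite -/kd => lt.
  rewrite ifT; last by lia.
  by rewrite addKn addnA HC.
- apply: (labelled_frame lb f isT) => y yw; last by rewrite (fr_im f).
  by rewrite H ifF //; rewrite /bb; lia.
Qed.

Definition search_time := (32 * nd + 21 * (kd + d) + 7 * d + 20)%N.

Lemma searchP C (c : 'rV[R]_d) a b s :
  two_nearest (ext C c) a b -> labelled (ext C c) a b s ->
  runs search s (k.+1 * (search_time + 7 * kd + 12) + 7 * kd + 15) (fun s' =>
    exists C', [/\ encodes P C' s' & foresight_iteration P C c C']).
Proof.
move=> tn lb; have e := lb_env lb; set T := search_time.
apply: (@runs_time _ (3 + (T + ((7 * kd + 7) + (1 +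
  ((k * (T + ((7 * kd + 7).+1 + 1) + 2) + 2) + (4 + (7 * kd + 2)))))))); first by lia.
apply: runs_seq; apply: runs_block => //=; rewrite /upd /=; set s1 := set_ireg _ _ _.
have lb1 : labelled (ext C c) a b s1.
  by do 2!apply: labelled_set_ireg => //.
apply: runs_seq.
apply: runs_conseq (candidate_spec (i := ord_max) tn lb1 _ _); last 2 first.
- by rewrite /s1 /= /upd /= (e_k e).
- by rewrite /s1 /= /upd /= (e_kd e).
move=> s2 [init]; rewrite ext_keep => -[ll cE HW lb2 _].
apply: runs_seq.
apply: runs_conseq (keepP lb2 HW) => s3 [bE HB lb3].
rewrite cE in bE.
apply: runs_seq; apply: runs_instr => //=; set s4 := set_ireg _ _ _.
have lb4 : labelled (ext C c) a b s4.
  exact: labelled_set_ireg.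
have e4 := lb_env lb4.
apply: runs_seq.
(* [swap_loop] consumes its list from the front, whereas the program adds rounds at the end. Hence
   the invariant is a continuation: whatever the remaining indices make of [best] is a result of the
   full loop from [init]. *)
pose I m s' := exists best,
  [/\ [/\ forall out, swap_loop P C c (drop m (enum 'I_k)) best out ->
            swap_loop P C c (enum 'I_k) init out,
          rreg s' xBest = Phi_assign P best.1 best.2 &
          holds_points (rmem s') bb best.1],
      labelled (ext C c) a b s' & ireg s' iIO = (m * d)%N].
apply: runs_conseq (runs_loop (N := k) (I := I) _ _ _ _ _ _) => //=.
- move=> s5 [best [[Hsl _ HBb] lb5 _]]; have e5 := lb_env lb5.
  apply: runs_seq; apply: runs_block => //=; rewrite /upd /=; set s6 := set_ireg _ _ _.
  apply: runs_frame.
  apply: runs_conseq (copyP (src := bb) (dst := nd) (N := kd) _ _ _ _ _);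
    rewrite /s6 //= /upd /= ?(e_one e5) ?(e_bb e5) ?(e_nd e5) ?(e_kd e5) //;
    last by rewrite /bb /wb; lia.
  move=> s7 H f7; exists best.1; split.
    split; rewrite ?(fr_i f7) //= /upd /= ?(e_n e5) ?(e_d e5) ?(e_k e5) // => p j.
      rewrite H ifF; last by have := cell_lt p j; rewrite -/nd; lia.
      exact: lb_P lb5 p j.
    rewrite H ifT; last by have := cell_lt p j; rewrite -/kd -/nd; lia.
    rewrite -HBb; congr (rmem s5 _); rewrite -/nd; lia.
  exists init, best.2; split=> //; apply: Hsl; rewrite drop_oversize ?size_enum_ord //.
  by case: (best) => *; exact: SwapNil.
- exact: e_one e4.
- exact: e_k e4.
- exists init; split=> //; first by split=> // out; rewrite drop0.
  exact: labelled_set_ireg.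
move=> m s5 mk sm f [best [[Hsl bE5 HBb] lb5 sIO]].
apply: runs_seq; apply: runs_frame.
apply: runs_conseq (candidate_spec (i := widen_ord (leqnSn k) (Ordinal mk)) tn lb5 sm sIO).
move=> s6 [cand]; rewrite ext_swap => -[llc cEc HWc lb6 rm6] f6.
pose best' := if Phi_assign P cand.1 cand.2 < Phi_assign P best.1 best.2 then cand else best.
apply: runs_seq; apply: runs_frame.
apply: (@runs_conseq _ (fun s' => [/\ rreg s' xBest = Phi_assign P best'.1 best'.2,
  holds_points (rmem s') bb best'.1 & labelled (ext C c) a b s'])).
- move=> s7 [h1 h2 h3] f7; apply: runs_instr => //=; exists best'; split.
  + split=> // out; move: (Hsl out) => {}Hsl H; apply: Hsl.
    rewrite (drop_nth (Ordinal mk)) ?size_enum_ord // (nth_ord_enum _ (Ordinal mk)).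
    exact: SwapCons llc H.
  + by do 2!apply: labelled_set_ireg => //.
  + rewrite /upd /= (fr_i f7) // (fr_i f6) // sIO (e_d (lb_env h3)).
    by rewrite mulSnr.
have b6 : rreg s6 xBest = Phi_assign P best.1 best.2 by rewrite (fr_r f6).
apply: runs_if; rewrite /= cEc b6 /best' => h.
  by rewrite h; apply: runs_conseq (keepP lb6 HWc) => s7 [q1 q2 q3]; split; rewrite // q1.
rewrite (negPf h); exists 1%N, s6; split; [exact: ExecSkip|by lia|].
split=> //; apply: holds_points_eq HBb _ => y yb; rewrite rm6 //; lia.
Qed.

End Specification.

(** * The law of the sampled index *)

Section Sampling.
Variable R : realType.
Implicit Types (D : nat -> R).

Let S D m := \sum_(0 <= q < m) D q.

Lemma partial_sum_le D p q : (forall q, 0 <= D q) -> (p <= q)%N -> S D p <= S D q.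
Proof.
move=> D0 pq; rewrite /S [leRHS](@big_cat_nat _ _ _ p) //=.
by rewrite lerDl sumr_ge0.
Qed.

Lemma pick_index0 D m : (forall q, 0 <= D q) -> pick_index D 0 m = 0%N.
Proof.
move=> D0; elim: m => //= m ->.
by rewrite ltNge sumr_ge0.
Qed.

Lemma pick_index_between D r m : 0 < r -> r <= S D m ->
  S D (pick_index D r m) < r <= S D (pick_index D r m).+1.
Proof.
move=> r0; elim: m => [|m IH]; first by rewrite /S big_nil leNgt r0.
move=> rS /=; case: ifPn => [->//|].
by rewrite -leNgt; exact: IH.
Qed.

(** By monotonicity of the partial sums, the half-open intervals between consecutive ones are
    disjoint, so at most one of them contains [r]. *)
Lemma pick_indexE D r m p : (forall q, 0 <= D q) -> 0 < r -> r <= S D m ->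
  (pick_index D r m == p) = (S D p < r <= S D p.+1).
Proof.
move=> D0 r0 rS; apply/eqP/idP => [<-|/andP[p1 p2]]; first exact: pick_index_between.
have /andP[q1 q2] := pick_index_between r0 rS.
case: (ltngtP (pick_index D r m) p) => // [lt|gt].
  by have := le_lt_trans (le_trans q2 (partial_sum_le D0 lt)) p1; rewrite ltxx.
by have := le_lt_trans (le_trans p2 (partial_sum_le D0 gt)) q1; rewrite ltxx.
Qed.

(** The flag [c] treats a closed and an open left end at once; inside the unit interval the density
    is 1. *)
Lemma uniform_prob_itv (c : bool) (x y : R) : 0 <= x -> x <= y -> y <= 1 ->
  uniform_prob (@ltr01 R) [set` Interval (BSide c x) (BRight y)] = (y - x)%:E.
Proof.
move=> x0 xy y1; rewrite /uniform_prob.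
under eq_integral => u.
  rewrite inE /= itv_boundlr /= => /andP[h1 h2].
  have -> : uniform_pdf 0 1 u = 1.
    rewrite /uniform_pdf ifT ?subr0 ?invr1 //; apply/andP; split.
      by apply: (le_trans x0); case: c h1 => //=; rewrite bnd_simp // => /ltW.
    by apply: le_trans y1; move: h2; rewrite bnd_simp.
  over.
rewrite /= integral_cst; last exact: measurable_itv.
rewrite mul1e; etransitivity; first exact: lebesgue_measure_itv.
rewrite /= lte_fin.
case: ltP => [_|yx]; first by rewrite EFinB.
have -> : y = x by apply/le_anti; rewrite xy yx.
by rewrite subrr.
Qed.

Lemma pick_index_uniform (disp : measure_display) (Om : measurableType disp)
    (Pr : probability Om R) (U : nat -> {RV Pr >-> R}) (D : nat -> R) (n p : nat) :
  iid_uniform U -> (forall q, 0 <= D q) -> (p < n)%N ->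
  let A := [set w : Om | pick_index D (U 0%N w * S D n) n = p] in
  measurable A /\ (S D n != 0 -> Pr A = (D p / S D n)%:E).
Proof.
move=> [U01 Ulaw _] D0 pn A.
(* With a zero total the index is constantly 0, so the event is everything or empty; measurability
   is still claimed. *)
have [Sn0|Sn0] := eqVneq (S D n) 0.
  split=> //; rewrite /A Sn0; under eq_set do rewrite mulr0 pick_index0 //.
  have [->|/eqP pn0] := eqVneq 0%N p.
    by rewrite (_ : [set _ | _] = setT) //; apply/seteqP; split.
  by rewrite (_ : [set _ | _] = set0) //; apply/seteqP; split.
have Sn_gt0 : 0 < S D n by rewrite lt_neqAle eq_sym Sn0 sumr_ge0.
(* The interval is closed on the left exactly for [p = 0], since the sample 0 selects index 0. *)
set I := Interval (BSide (p == 0%N) (S D p / S D n)) (BRight (S D p.+1 / S D n)).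
have AE : A = U 0%N @^-1` [set` I].
  suff H w : A w <-> [set` I] (U 0%N w) by apply/seteqP; split=> w /H.
  have /andP[u0 u1] := U01 0%N w; rewrite /A /=; move: (U 0%N w) u0 u1 => u u0 u1.
  rewrite itv_boundlr /=.
  have SE q : (u <= S D q / S D n) = (u * S D n <= S D q) by rewrite ler_pdivlMr.
  have SE' q : (S D q / S D n < u) = (S D q < u * S D n) by rewrite ltr_pdivrMr.
  have [->|un0] := eqVneq u 0.
    rewrite mul0r pick_index0 // [X in _ && X]bnd_simp divr_ge0 ?sumr_ge0 // andbT.
    have [->|pn0] := eqVneq p 0%N; first by rewrite bnd_simp /S big_nil mul0r lexx.
    rewrite bnd_simp ltNge divr_ge0 ?sumr_ge0 //=; split=> // E.
    by rewrite -E eqxx in pn0.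
  have u_gt0 : 0 < u by rewrite lt_neqAle eq_sym un0.
  have uS : u * S D n <= S D n by rewrite ler_piMl // ltW.
  have -> : (pick_index D (u * S D n) n = p) = (S D p < u * S D n <= S D p.+1).
    by rewrite -(pick_indexE p D0 _ uS) ?mulr_gt0 //; apply/propext; split => /eqP.
  have [->|pn0] := eqVneq p 0%N; rewrite !bnd_simp SE ?SE' //.
  by rewrite /S !big_nil mul0r u0 mulr_gt0.
have mI : measurable [set` I] by exact: measurable_itv.
have mA : measurable A by rewrite AE; exact: measurable_funPTI.
split=> // _; have -> : Pr A = distribution Pr (U 0%N) [set` I] by rewrite AE.
rewrite Ulaw // uniform_prob_itv.
- by rewrite -mulrBl /S big_nat_recr //= addrAC subrr add0r.
- by rewrite divr_ge0 ?sumr_ge0.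
- by rewrite ler_pM2r ?invr_gt0 //; apply: partial_sum_le.
- by rewrite ler_pdivrMr // mul1r; apply: partial_sum_le.
Qed.
End Sampling.

(** Extended by 0 to all naturals, so that the weights are nonnegative everywhere, as the lemmas on
    [pick_index] assume. *)
Definition sq_dists (R : realType) (n d k : nat) (P : 'I_n -> 'rV[R]_d)
    (C : 'I_k -> 'rV[R]_d) (q : nat) : R :=
  oapp (fun p : 'I_n => dist_centers (P p) C ^+ 2) 0 (insub q).

Lemma sq_dists_ge0 (R : realType) n d k (P : 'I_n -> 'rV[R]_d)
  (C : 'I_k -> 'rV[R]_d) q : 0 <= sq_dists P C q.
Proof. by rewrite /sq_dists; case: insub => //= p; exact: sqr_ge0. Qed.

Lemma sq_distsE (R : realType) n d k (P : 'I_n -> 'rV[R]_d)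
  (C : 'I_k -> 'rV[R]_d) (p : 'I_n) : sq_dists P C p = dist_centers (P p) C ^+ 2.
Proof. by rewrite /sq_dists valK. Qed.

Lemma sum_sq_dists (R : realType) n d k (P : 'I_n -> 'rV[R]_d)
  (C : 'I_k -> 'rV[R]_d) : \sum_(0 <= q < n) sq_dists P C q = Phi P C.
Proof. by rewrite big_mkord; apply: eq_bigr => p _; rewrite sq_distsE. Qed.

Lemma eq_pick_index (R : realType) (D D' : nat -> R) r m :
  (forall q, (q < m)%N -> D q = D' q) -> pick_index D r m = pick_index D' r m.
Proof.
elim: m => //= m IH H; rewrite IH; last by move=> q qm; apply: H; lia.
rewrite (_ : \sum_(0 <= q < m) D q = \sum_(0 <= q < m) D' q) //.
by apply: eq_big_nat => q /andP[_ qm]; apply: H; lia.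
Qed.

(** * Assembly of the whole iteration *)

Lemma dist_centers_ext (R : realType) n d k (P : 'I_n -> 'rV[R]_d)
    (C : 'I_k -> 'rV[R]_d) (i0 : 'I_k) a b p :
  two_nearest P (ext C (C i0)) a b ->
  dist_centers (P p) C = l2norm (P p - ext C (C i0) (a p)).
Proof.
move=> tn; have [i -> imin] := dist_centersP (P p) C (leq_ltn_trans (leq0n _) (ltn_ord i0)).
have extw j : ext C (C i0) (widen_ord (leqnSn k) j) = C j by rewrite /ext /= valK.
apply/le_anti; have := tn_first tn p (widen_ord (leqnSn k) i).
rewrite extw => ->; rewrite andbT.
by rewrite /ext; case: insub => /= *; exact: imin.
Qed.

Lemma foresightP (R : realType) n d k (P : 'I_n -> 'rV[R]_d)
    (C : 'I_k -> 'rV[R]_d) (s : state R) (cn : 'I_n) :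
  (0 < k)%N -> encodes P C s ->
  cn = pick_index (sq_dists P C) (tape s 0%N * Phi P C) n :> nat ->
  let nearest_time := (n * (k.+1 * (10 * d + 17) + 11 * d + 15) + 3)%N in
  runs foresight s ((3 * n + 3 * k + 18) + (4 + ((7 * d + 2) + (nearest_time +
    ((15 * n + 7 * d + 16) + (nearest_time +
    (k.+1 * (search_time n d k + 7 * (k * d) + 12) + 7 * (k * d) + 15)))))))
    (fun s' => exists C', encodes P C' s' /\ foresight_iteration P C (P cn) C').
Proof.
move=> k0 [sN sD sK sP sC] cnE nt; set nd := (n * d)%N; set kd := (k * d)%N.
have HP : holds_points (rmem s) 0 P by [].
have HC : holds_points (rmem s) nd C by [].
have n0 : (0 < n)%N by apply: leq_ltn_trans (ltn_ord cn).
apply: runs_seq; apply: runs_frame; apply: runs_conseq (setupP sN sD sK) => s1 e1 f1.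
have rm1 : rmem s1 = rmem s by rewrite (fr_rm f1).
apply: runs_seq; apply: runs_block => //=.
rewrite /upd /= (e_nd e1) (e_kd e1) (e_d e1); set s2 := set_ireg _ _ _.
have e2 : env n d k nd kd s2 by case: e1 => *; split.
apply: runs_seq; apply: runs_frame.
apply: runs_conseq (copyP (src := nd) (dst := (nd + kd)%N) (N := d) _ _ _ _ _);
  rewrite /s2 //= /upd /= ?(e_one e1) ?(e_nd e1) ?(e_kd e1) ?(e_d e1) //; last first.
  (* The first center ends before slot [k] begins, because [0 < k]. *)
  by rewrite leq_add2l leq_pmull // orbT.
rewrite rm1 => s3 H3 f3; have e3 := env_frame f3 e2 isT.
have HP3 : holds_points (rmem s3) 0 P.
  by apply: holds_points_eq HP _ => y yn; rewrite H3 ifF //; rewrite /nd /kd; lia.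
have HC3 : holds_points (rmem s3) nd C.
  by apply: holds_points_eq HC _ => y yn; rewrite H3 ifF //; rewrite /nd /kd in yn *; lia.
have HE3 : holds_points (rmem s3) nd (ext C (C (Ordinal k0))).
  apply: holds_ext HC3 _ => j; rewrite H3 ifT; last by have := ltn_ord j; rewrite /nd /kd; lia.
  by rewrite addKn; have := HC (Ordinal k0) j; rewrite /= mul0n addn0.
apply: runs_seq; apply: runs_frame.
apply: runs_conseq (nearest_two_spec k0 e3 HP3 HE3) => s4 [a [b [tn lb4 D4 rm4]]] f4.
have e4 := lb_env lb4.
set db := (nd + (kd + d) + (kd + d) + (kd + d) + (kd + d))%N in D4 rm4.
have DE q : (q < n)%N -> rmem s4 (db + q)%N = sq_dists P C q.
  move=> qn; rewrite (D4 (Ordinal qn)) -(dist_centers_ext _ tn).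
  exact/esym/(sq_distsE P C (Ordinal qn)).
have DS : \sum_(0 <= p < n) rmem s4 (db + p)%N = Phi P C.
  by rewrite -sum_sq_dists; apply: eq_big_nat => q /andP[_]; exact: DE.
have t4 : tape s4 = tape s by rewrite (fr_t f4) // (fr_t f3) //= (fr_t f1).
apply: runs_seq; apply: runs_frame.
apply: runs_conseq (sampleP n0 e4) => s5; rewrite -/nd -/kd -/db DS t4 (eq_pick_index _ DE) -cnE.
move=> H5 f5; have e5 := env_frame f5 e4 isT.
have HP5 : holds_points (rmem s5) 0 P.
  by apply: holds_points_eq (lb_P lb4) _ => y yn; rewrite H5 ifF //; rewrite /nd /kd; lia.
have HC5 : holds_points (rmem s5) nd C.
  apply: holds_points_eq HC3 _ => y yn; rewrite H5 ifF; last by rewrite /nd /kd in yn *; lia.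
  by apply: rm4; rewrite /nd /kd in yn *; lia.
have HE5 : holds_points (rmem s5) nd (ext C (P cn)).
  apply: holds_ext HC5 _ => j; rewrite H5 ifT; last by have := ltn_ord j; rewrite /nd /kd; lia.
  by rewrite addKn; exact: (lb_P lb4).
apply: runs_seq.
apply: runs_conseq (nearest_two_spec k0 e5 HP5 HE5) => s6 [a' [b' [tn' lb6 _ _]]].
apply: runs_conseq (searchP tn' lb6) => s7 [C' [? ?]].
by exists C'.
Qed.

(* One program and one constant serve all n, d, k, P and C. The program starts
   from any memory holding P and C and leaves there P and the new centers, as
   the body of the main loop must. For every tape w of samples, cnew w is the
   index of the point used as c_new. *)
Theorem lemma1 (R : realType) :
  exists (prog : cmd) (A : nat),
  forall (n d k : nat) (P : 'I_n -> 'rV[R]_d) (C : 'I_k -> 'rV[R]_d)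
         (s : state R),
    (0 < d)%N -> (0 < k)%N -> (k <= n)%N -> injective P -> encodes P C s ->
  exists cnew : (nat -> R) -> 'I_n,
    (forall (disp : measure_display) (Om : measurableType disp)
            (Pr : probability Om R) (U : nat -> {RV Pr >-> R}),
       iid_uniform U ->
       sample_center Pr P C (fun w : Om => cnew (fun i => U i w))) /\
    (forall w : nat -> R, (forall i, 0 <= w i <= 1) ->
       exists (t : nat) (s' : state R) (C' : 'I_k -> 'rV[R]_d),
         [/\ exec prog (set_tape s w) t s',
             (t <= A * (n * d * k))%N,
             encodes P C' s'
           & foresight_iteration P C (P (cnew w)) C']).
Proof.
(* Bounding each monomial of the running time by [n * d * k] gives coefficients adding up to 503;
   600 leaves some slack. *)
exists foresight, 600%N => n d k P C s d0 k0 kn _ enc.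
have n0 : (0 < n)%N by exact: leq_trans kn.
(* The index depends on [P], [C] and the first sample only, so one formula is both the random
   variable whose law is required and the value that the program computes. *)
exists (fun w => Ordinal (pick_index_lt (sq_dists P C) (w 0%N * Phi P C) n0)); split.
  move=> disp Om Pr U Uu p.
  have := pick_index_uniform Uu (sq_dists_ge0 P C) (ltn_ord p).
  rewrite /= sum_sq_dists sq_distsE; congr (measurable _ /\ (_ -> Pr _ = _));
    by apply/seteqP; split=> w /=; [move=> E; exact: val_inj|move=> <-].
move=> w _; have enc' : encodes P C (set_tape s w) by case: enc => *; split.
have [t [s' [e le [C' [enc2 it]]]]] := foresightP
  (cn := Ordinal (pick_index_lt (sq_dists P C) (w 0%N * Phi P C) n0)) k0 enc' erefl.
exists t, s', C'; split=> //; apply: leq_trans le _.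
rewrite /search_time.
have h1 : (n * d <= n * d * k)%N by rewrite leq_pmulr.
have h2 : (n <= n * d)%N by rewrite leq_pmulr.
have h3 : (n * k <= n * d * k)%N by rewrite mulnAC leq_pmulr.
(* Here [k <= n] absorbs the cost of handling the centers themselves. *)
have h4 : (k * d <= n * d)%N by rewrite leq_mul2r kn orbT.
have h5 : (k * d * k <= n * d * k)%N by rewrite leq_mul2r h4 orbT.
have h6 : (d <= k * d)%N by rewrite leq_pmull.
lia.
Qed.
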